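(* Any mass distribution $\mu$ in $\mathbb{R}^4$ can be equipartitioned in $12=3\times 2\times 2$ boxes by a collection of $4$ hyperplanes two of which are parallel; that is, there exist two parallel hyperplanes and two additional non-parallel hyperplanes in $\mathbb{R}^4$ such that each of the $12$ boxes they determine has $\mu$-measure $\frac{1}{12}\mu(\mathbb{R}^4)$.
   Context: A mass distribution in $\mathbb{R}^4$ is a finite Borel measure $\mu$ of the form $\mu(A)=\int_A f\,dx$ for an integrable density function $f:\mathbb{R}^4\to\mathbb{R}$ (integration with respect to Lebesgue measure), such that every nonempty open subset of $\mathbb{R}^4$ has positive $\mu$-measure. The two additional hyperplanes being non-parallel means that neither is parallel to the two parallel hyperplanes and that they are not parallel to each other. Boxes: the two parallel hyperplanes divide $\mathbb{R}^4$ into $3$ consecutive regions, and each additional hyperplane divides $\mathbb{R}^4$ into two half-spaces; the $3\times 2\times 2$ boxes are the intersections of one of the $3$ regions with one half-space of each of the two additional hyperplanes. *)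

(* Defs.v *)
From HB Require Import structures.
From mathcomp Require Import all_boot all_order all_algebra.
From mathcomp Require Import all_classical all_reals all_analysis.

Set Implicit Arguments.
Unset Strict Implicit.
Unset Printing Implicit Defensive.

Import Order.TTheory GRing.Theory Num.Theory.
Import numFieldNormedType.Exports.

Local Open Scope classical_set_scope.
Local Open Scope ring_scope.

(* R^4 is the iterated product R * R * R * R: its topology and its vector space
   structure are the product ones.  [measurableTypeR R] is R with its Borel
   sigma-algebra; since R is second countable, the product sigma-algebra on
   [borel4 R] is the Borel sigma-algebra of R^4. *)
Notation space4 R := (R * R * R * R)%type.
Notation borel4 R := (space4 (measurableTypeR R)).

Section Defs.
Context {R : realType}.

Definition lebesgue4 : {measure set (borel4 R) -> \bar R} :=
  (((@lebesgue_measure R \x @lebesgue_measure R) \x @lebesgue_measure R)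
     \x @lebesgue_measure R)%E.

(* The density f is not required to be nonnegative: this follows almost
   everywhere from mu being a measure. *)
Definition mass_distribution (mu : {finite_measure set (borel4 R) -> \bar R}) :=
  (exists f : space4 R -> R,
     lebesgue4.-integrable [set: borel4 R] (fun x => (f x)%:E) /\
     forall A : set (borel4 R), measurable A ->
       mu A = (\int[lebesgue4]_(x in A) (f x)%:E)%E) /\
  (forall U : set (space4 R), open U -> U !=set0 -> (0 < mu U)%E).

Definition dot4 (a x : space4 R) : R :=
  a.1.1.1 * x.1.1.1 + a.1.1.2 * x.1.1.2 + a.1.2 * x.1.2 + a.2 * x.2.

(* A genuine hyperplane when a != 0. *)
Definition hyperplane (a : space4 R) (s : R) : set (space4 R) :=
  [set x | dot4 a x = s].

(* Parallel affine hyperplanes are translates of each other; in particular a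
   hyperplane is parallel to itself. *)
Definition parallel (H K : set (space4 R)) : Prop :=
  exists v : space4 R, K = [set x + v | x in H].

(* The three consecutive regions cut out by two distinct parallel hyperplanes,
   written with a common normal as a.x = s and a.x = t with s < t.  All regions
   and half-spaces are taken closed; hyperplanes are null for an absolutely
   continuous measure, so the choice of boundary does not affect the boxes'
   measures. *)
Definition slab (a : space4 R) (s t : R) (i : 'I_3) : set (space4 R) :=
  match val i with
  | 0%N => [set x | dot4 a x <= s]
  | 1%N => [set x | s <= dot4 a x <= t]
  | _ => [set x | t <= dot4 a x]
  end.

Definition halfspace (a : space4 R) (s : R) (side : bool) : set (space4 R) :=
  if side then [set x | s <= dot4 a x] else [set x | dot4 a x <= s].

End Defs.

(* Main.v *)
Require Import Defs.
From HB Require Import structures.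
From mathcomp Require Import all_boot all_order all_algebra all_fingroup.
From mathcomp Require Import all_classical all_reals all_analysis.
From mathcomp Require Import zify measurable_realfun ring lra.

(** The common normal [a] of the parallel hyperplanes determines both of them, by
    the requirement that the three slabs have equal mass; replacing [a] by [-a]
    exchanges the outer slabs.  It remains to find [a] and two affine functions
    [b], [c] such that the sign functions of [b], of [c] and of [bc] have mean
    zero on every slab.  Let [a] range over S^3, [b] over S^4 and [c] over a
    2-sphere: this is a system of nine equations on a nine-dimensional manifold,
    equivariant for the sign changes of [a], [b] and [c].  Taking the sum and the
    difference over the outer slabs makes every equation odd or even in each sign,
    and the mod 2 Euler class of the system is
      y^2 z^2 (y + z)^2 (x + y) (x + z) (x + y + z),
    where x, y, z are the classes of the three sign characters.  Modulo x^4, y^5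
    and z^3 it is x^3 y^4 z^2, so that a common zero exists.

    The Euler class argument is carried out by hand on a cubical grid.  Each
    sphere is a closed cube (a hemisphere) with antipodal boundary points
    identified, each equation defines a mod 2 cochain by its sign, and the cup
    product of the nine coboundaries is summed over all simplices of the grid.
    The sum depends only on the symmetries; it is 1 for a suitable standard choice
    of cochains, and 0 if on every small simplex some equation has constant sign. *)

Import Order.TTheory GRing.Theory Num.Theory.
Import numFieldNormedType.Exports.

Set Implicit Arguments.
Unset Strict Implicit.
Unset Printing Implicit Defensive.

(** * Mod 2 cup products on a grid *)

(** Terms paired by a fixed-point-free involution cancel mod 2; comparing ranks selects one member
    of each pair. *)
Lemma sum_involution_bool (T : finType) (iota : T -> T) (F : T -> bool) :
  involutive iota -> (forall x, iota x != x) -> (forall x, F (iota x) = F x) ->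
  (\sum_x F x = 0)%R.
Proof.
move=> iotaK iotaN Fi.
rewrite (bigID (fun x => enum_rank x < enum_rank (iota x))) /=.
rewrite [X in (_ + X)%R](reindex_inj (inv_inj iotaK)) /=.
rewrite [X in (_ + X)%R](eq_bigl (fun x => enum_rank x < enum_rank (iota x))).
  rewrite [X in (_ + X)%R](eq_bigr F); last by move=> x _; rewrite Fi.
  exact: addbb.
move=> x; rewrite iotaK -leqNgt leq_eqVlt.
case: eqP => // /ord_inj /enum_rank_inj /esym /eqP; by rewrite (negbTE (iotaN x)).
Qed.

Section Grid.
(** [blk d] is the cube containing coordinate [d], and [chi i B] says that equation [i] is odd in
    cube [B]. A simplex is a unit cell with the order in which its coordinates move. *)
Context (n m : nat) (K : finType) (blk : 'I_n -> K) (chi : 'I_n -> pred K).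

Local Notation vtx := ('I_n -> nat).
Local Notation cell := {ffun 'I_n -> 'I_(m.*2)}.
Local Notation smplx := (cell * {perm 'I_n})%type.

Definition lo (a : nat) := if odd a then a.+1 else a.
Definition hi (a : nat) := if odd a then a else a.+1.

(* Each unit interval is oriented from its even to its odd end; this makes the
   triangulation of the grid invariant under the reflections x |-> 2m - x. *)
Definition vert (t : smplx) (k : nat) : vtx :=
  fun d => if (t.2^-1)%g d < k then hi (t.1 d) else lo (t.1 d).

Definition neg (B : K) (x : vtx) : vtx :=
  fun d => if blk d == B then m.*2 - x d else x d.

Definition onbd (a : nat) := (a == 0) || (a == m.*2).

Definition bd (B : K) (x : vtx) :=
  [forall d, x d <= m.*2] && [exists d, (blk d == B) && onbd (x d)].

(** [flip_hi] and [flip_lo] give the other unit interval with the same odd, respectively even, end.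
    Odd ends are never on the boundary, so only [flip_lo] needs a condition. *)
Definition flip_hi (a : nat) := if odd a then a.-1 else a.+1.
Definition flip_lo (a : nat) := if odd a then a.+1 else a.-1.

Lemma flip_hi_lt a : a < m.*2 -> flip_hi a < m.*2.
Proof. by rewrite /flip_hi; case: ifP => ?; lia. Qed.

Definition ord_flip_hi (a : 'I_(m.*2)) := Ordinal (flip_hi_lt (ltn_ord a)).

Lemma flip_lo_lt a : a < m.*2 -> ~~ onbd (lo a) -> flip_lo a < m.*2.
Proof. by rewrite /flip_lo /lo /onbd; case: ifP => ?; lia. Qed.

Lemma lo_flip_lo a : ~~ onbd (lo a) -> lo (flip_lo a) = lo a.
Proof.
rewrite /flip_lo /onbd /lo; case: a => [|a] //=.
by case oa: (odd a); rewrite /= ?oa.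
Qed.

Lemma flip_loK a : ~~ onbd (lo a) -> flip_lo (flip_lo a) = a.
Proof.
rewrite /flip_lo /onbd /lo; case: a => [|a] //=.
by case oa: (odd a); rewrite /= ?oa.
Qed.

Lemma flip_lo_neq a : ~~ onbd (lo a) -> flip_lo a <> a.
Proof. by rewrite /flip_lo /onbd /lo; case: ifP => ?; lia. Qed.

Lemma rev_ord_neq (a : 'I_(m.*2)) : rev_ord a <> a.
Proof. by move/(congr1 val) => /=; have := ltn_ord a; lia. Qed.

Definition ord_flip_lo (a : 'I_(m.*2)) : 'I_(m.*2) :=
  insubd (rev_ord a) (flip_lo a).

Lemma ord_flip_loE (a : 'I_(m.*2)) :
  ~~ onbd (lo a) -> ord_flip_lo a = flip_lo a :> nat.
Proof. by move=> h; rewrite val_insubd flip_lo_lt. Qed.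

Lemma lo_rev (a : 'I_(m.*2)) : lo (rev_ord a) = m.*2 - lo a.
Proof.
by rewrite /lo /=; have := ltn_ord a; case: ifP; case: ifP => ? ? ?; lia.
Qed.

Lemma hi_rev (a : 'I_(m.*2)) : hi (rev_ord a) = m.*2 - hi a.
Proof.
by rewrite /hi /=; have := ltn_ord a; case: ifP; case: ifP => ? ? ?; lia.
Qed.

Lemma vert_le t k d : vert t k d <= m.*2.
Proof.
rewrite /vert /lo /hi; have := ltn_ord (t.1 d).
by case: ifP; case: ifP => ? ? ?; lia.
Qed.

Definition upd (c : cell) (d0 : 'I_n) (g : 'I_(m.*2) -> 'I_(m.*2)) : cell :=
  [ffun d => if d == d0 then g (c d) else c d].

(** Exchanging the moves into and out of vertex [k] changes no other vertex, so the simplices cancel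
    in pairs. *)
Lemma sum_face_inner (k : nat) (H : (nat -> vtx) -> bool) : 0 < k < n ->
  (forall w w', (forall l, l <= n -> l != k -> w l = w' l) -> H w = H w') ->
  (\sum_(t : smplx) H (vert t) = 0)%R.
Proof.
move=> /andP[k0 kn] Hk.
have k1n : k.-1 < n by lia.
pose p := tperm (Ordinal k1n) (Ordinal kn).
apply: (@sum_involution_bool _ (fun t : smplx => (t.1, (p * t.2)%g))).
- by move=> [c s] /=; rewrite mulgA tperm2 mul1g.
- move=> [c s] /=; apply/eqP => -[] /(congr1 (fun q => (q * s^-1)%g (Ordinal k1n))).
  rewrite -mulgA mulgV mulg1 perm1 tpermL => /(congr1 val) /=; lia.
- move=> [c s] /=; apply: Hk => l ln lk; apply: funext => d.
  rewrite /vert /= invMg tpermV permM.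
  by case: tpermP => [->|->|//] /=; congr (if _ then _ else _); lia.
Qed.

(** The coordinate that moves first is at its even end only at vertex 0, so reflecting its interval
    in the odd end changes no other vertex. *)
Lemma sum_face_first (H : (nat -> vtx) -> bool) : 0 < n ->
  (forall w w', (forall l, l <= n -> l != 0 -> w l = w' l) -> H w = H w') ->
  (\sum_(t : smplx) H (vert t) = 0)%R.
Proof.
move=> n0 Hk; pose z := Ordinal n0.
apply: (@sum_involution_bool _ (fun t : smplx => (upd t.1 (t.2 z) ord_flip_hi, t.2))).
- move=> [c s]; congr pair; apply/ffunP => d; rewrite !ffunE /=.
  case: eqP => // _; apply: val_inj => /=; rewrite /flip_hi.
  by case: ifP; case: ifP => ? ?; lia.
- move=> [c s] /=; apply/eqP => -[] /ffunP /(_ (s z)).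
  by rewrite ffunE eqxx => /(congr1 val) /=; rewrite /flip_hi; case: ifP => ? ?; lia.
- move=> [c s] /=; apply: Hk => l ln lk; apply: funext => d.
  rewrite /vert /= ffunE; case: eqP => // ->; rewrite permK /= lt0n lk.
  by rewrite /hi /flip_hi /=; case: ifP; case: ifP => ? ?; lia.
Qed.

(** The coordinate that moves last is at its odd end only at vertex [n]. Its interval is reflected
    in the even end, unless that end is on the boundary: then the face formed by the other vertices
    lies in the boundary, and the antipode of its cube pairs it with another boundary face. *)
Lemma sum_face_last (H : (nat -> vtx) -> bool) : 0 < n ->
  (forall w w', (forall l, l < n -> w l = w' l) -> H w = H w') ->
  (forall B w, (forall l, l < n -> bd B (w l)) -> H (fun l => neg B (w l)) = H w) ->
  (\sum_(t : smplx) H (vert t) = 0)%R.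
Proof.
move=> n0 Hk Hneg.
have n1n : n.-1 < n by lia.
pose z := Ordinal n1n.
pose f (t : smplx) : smplx := (if onbd (lo (t.1 (t.2 z))) then
   [ffun d => if blk d == blk (t.2 z) then rev_ord (t.1 d) else t.1 d]
  else upd t.1 (t.2 z) ord_flip_lo, t.2).
have lt_last (s : {perm 'I_n}) l : l < n -> (s^-1)%g (s z) < l = false.
  by move=> ln; rewrite permK /=; lia.
apply: (@sum_involution_bool _ f).
- move=> [c s]; rewrite /f /=; congr pair; apply/ffunP => d.
  case: (boolP (onbd (lo (c (s z))))) => hb.
    rewrite !ffunE eqxx lo_rev.
    have -> : onbd (m.*2 - lo (c (s z))) by move: hb; rewrite /onbd; lia.
    by rewrite !ffunE; case: eqP => // _; rewrite rev_ordK.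
  rewrite !ffunE eqxx ord_flip_loE //.
  have hb' : ~~ onbd (lo (flip_lo (c (s z)))) by rewrite lo_flip_lo.
  rewrite (negbTE hb') !ffunE; case: eqP => // ->.
  apply: val_inj; rewrite /= ord_flip_loE ord_flip_loE //.
  exact: flip_loK.
- move=> [c s]; rewrite /f /=; apply/eqP => -[].
  case: (boolP (onbd (lo (c (s z))))) => hb /ffunP /(_ (s z)).
    by rewrite ffunE eqxx => /rev_ord_neq.
  by rewrite ffunE eqxx => /(congr1 val) /=; rewrite ord_flip_loE // => /(flip_lo_neq hb).
- move=> [c s]; rewrite /f /=.
  case: (boolP (onbd (lo (c (s z))))) => hb.
    rewrite -[RHS](Hneg (blk (s z))).
      apply: Hk => l ln; apply: funext => d; rewrite /vert /neg /= ffunE.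
      by case: eqP => // _; rewrite lo_rev hi_rev; case: ifP.
    move=> l ln; apply/andP; split; first by apply/forallP => d; exact: vert_le.
    by apply/existsP; exists (s z); rewrite eqxx /vert /= lt_last.
  apply: Hk => l ln; apply: funext => d; rewrite /vert /= ffunE.
  by case: eqP => // ->; rewrite lt_last // ord_flip_loE // lo_flip_lo.
Qed.

Definition twisted (e : 'I_n -> vtx -> bool) :=
  forall i B x, bd B x -> e i (neg B x) = e i x (+) chi i B.

(* The cup product of the coboundaries of the [e i], evaluated on the sum of all
   simplices. *)
Definition cup (e : 'I_n -> vtx -> bool) : bool :=
  (\sum_(t : smplx) \prod_(i < n) (e i (vert t i) + e i (vert t i.+1)))%R.

(** * Invariance of the cup product *)

Section Invariance.
Context (e : 'I_n -> vtx -> bool) (h : vtx -> bool) (i : 'I_n).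
Hypothesis e_tw : forall j, j != i ->
  forall B x, bd B x -> e j (neg B x) = e j x (+) chi j B.
Hypothesis h_inv : forall B x, bd B x -> h (neg B x) = h x.

(** Terms of the Leibniz rule: [h] is evaluated at vertex [b], and the coboundary of [e j] on the
    edge from vertex [a j] to the next one. *)
Let P (a : 'I_n -> nat) (b : nat) (w : nat -> vtx) : bool :=
  (h (w b) * \prod_(j < n | j != i) (e j (w (a j)) + e j (w (a j).+1)))%R.

Let T a b : bool := (\sum_(t : smplx) P a b (vert t))%R.

(* The two sums differ by a sum that does not involve vertex [k]. *)
Let T_shift (a a' : 'I_n -> nat) (b : nat) (j0 : 'I_n) (k : nat) :
  0 < k < n -> b != k -> j0 != i -> a j0 = k -> a' j0 = k.-1 ->
  (forall j, j != i -> j != j0 -> a' j = a j) ->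
  (forall j, j != i -> j != j0 -> a j != k /\ (a j).+1 != k) ->
  (forall j, (a j) < n) -> b <= n ->
  T a b = T a' b.
Proof.
move=> kn bk ji aj a'j a'a ak an bn; apply/eqP; rewrite -subr_eq0; apply/eqP.
rewrite /T -sumrB.
pose H (w : nat -> vtx) : bool := (h (w b) *
  ((e j0 (w k.-1) + e j0 (w k.+1)) *
   \prod_(j < n | (j != i) && (j != j0)) (e j (w (a j)) + e j (w (a j).+1))))%R.
rewrite (eq_bigr (fun t => H (vert t))).
  apply: (sum_face_inner kn) => w w' ww'; rewrite /H !ww' //; try lia.
  congr (_ * (_ * _))%R; apply: eq_bigr => j /andP[j1 j2].
  by have [? ?] := ak _ j1 j2; rewrite !ww' //; exact: ltnW.
move=> t _; rewrite /P /H (bigD1 j0) //= [X in (_ - _ * X)%R](bigD1 j0) //=.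
rewrite aj a'j prednK; last by lia.
rewrite [X in (_ - _ * (_ * X))%R](eq_bigr
  (fun j => (e j (vert t (a j)) + e j (vert t (a j).+1))%R)); last first.
  by move=> j /andP[j1 j2]; rewrite a'a.
set X := (\prod_(_ < _ | _) _)%R.
by case: (h _) X (e j0 _) (e j0 _) (e j0 _) => [] [] [] [] [].
Qed.

Let T_first (a : 'I_n -> nat) (b : nat) :
  0 < b <= n -> (forall j, j != i -> 0 < a j < n) -> T a b = false.
Proof.
move=> b0 a0; apply: sum_face_first => [|w w' ww']; first by case: (i) => /=; lia.
rewrite /P ww' //; try lia.
by congr (_ * _)%R; apply: eq_bigr => j ji; have := a0 _ ji => ?; rewrite !ww' //; lia.
Qed.

(** Under an antipode, [e j] changes by the same [chi j B] at both ends of a boundary edge, so its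
    coboundary is invariant there. *)
Let T_last (a : 'I_n -> nat) (b : nat) :
  b < n -> (forall j, j != i -> (a j).+1 < n) -> T a b = false.
Proof.
move=> b0 a0; apply: sum_face_last => [|w w' ww'|B w bw].
- by case: (i) => /=; lia.
- rewrite /P ww' //.
  by congr (_ * _)%R; apply: eq_bigr => j ji; have := a0 _ ji => ?; rewrite !ww' //; lia.
- rewrite /P h_inv; last exact: bw.
  congr (_ * _)%R; apply: eq_bigr => j ji; have := a0 _ ji => ?.
  rewrite !e_tw //; try by apply: bw; lia.
  by case: (e _ _) (e _ _) (chi _ _) => [] [] [].
Qed.

(** The product is the coboundary of [h] times the other coboundaries, and [h] is well defined after
    antipodal boundary points are identified; the sum of all simplices is then a mod 2 cycle. *)
Lemma cup_coboundary :
  (\sum_(t : smplx) (h (vert t i) + h (vert t i.+1)) *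
    \prod_(j < n | j != i) (e j (vert t j) + e j (vert t j.+1)) = 0)%R.
Proof.
have i_n := ltn_ord i.
transitivity ((T (fun j => j) i + T (fun j => j) i.+1)%R : bool).
  by rewrite /T -big_split /=; apply: eq_bigr => t _; rewrite /P mulrDl.
(* Leibniz rule: move the factors after [i] down, one at a time, until the last
   vertex no longer occurs, and the factors before [i] up until vertex 0 no longer
   occurs. *)
pose a k (j : 'I_n) : nat := if i < j <= k then j.-1 else j.
have aT k : i + k < n -> T (fun j => j) i = T (a (i + k)) i.
  elim: k => [|k IH] kn.
    congr T; apply: funext => j; rewrite /a; case: ifP => //; lia.
  rewrite IH; last by lia.
  apply: (@T_shift _ _ _ (Ordinal kn) (i + k.+1)) => //; try lia.
  - by apply/eqP => /(congr1 val) /=; lia.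
  - by rewrite /a /=; case: ifP => //; lia.
  - by rewrite /a /=; case: ifP => //; lia.
  - move=> j ji /eqP jk; have {}jk : j <> i + k.+1 :> nat by move=> ?; apply: jk; apply: val_inj.
    by rewrite /a; case: ifP; case: ifP => //; lia.
  - move=> j /eqP ji /eqP jk; have {}jk : j <> i + k.+1 :> nat by move=> ?; apply: jk; apply: val_inj.
    have {}ji : j <> i :> nat by move=> ?; apply: ji; apply: val_inj.
    by rewrite /a; case: ifP => ?; lia.
  - by move=> j; have := ltn_ord j; rewrite /a; case: ifP => ?; lia.
rewrite (aT (n.-1 - i)); last by lia.
rewrite T_last //; last first.
  move=> j /eqP ji; have {}ji : j <> i :> nat by move=> ?; apply: ji; apply: val_inj.
  by have := ltn_ord j; rewrite /a; case: ifP => ?; lia.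
pose a' k (j : 'I_n) : nat := if i - k <= j < i then j.+1 else j.
have a'T k : k <= i -> T (fun j => j) i.+1 = T (a' k) i.+1.
  elim: k => [|k IH] kn.
    congr T; apply: funext => j; rewrite /a'; case: ifP => //; lia.
  rewrite IH; last by lia.
  have kn' : i - k.+1 < n by lia.
  symmetry; apply: (@T_shift _ _ _ (Ordinal kn') (i - k)) => //; try lia.
  - by apply/eqP => /(congr1 val) /=; lia.
  - by rewrite /a' /=; case: ifP => //; lia.
  - by rewrite /a' /=; case: ifP => //; lia.
  - move=> j ji /eqP jk; have {}jk : j <> i - k.+1 :> nat by move=> ?; apply: jk; apply: val_inj.
    by rewrite /a'; case: ifP; case: ifP => //; lia.
  - move=> j /eqP ji /eqP jk; have {}jk : j <> i - k.+1 :> nat by move=> ?; apply: jk; apply: val_inj.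
    have {}ji : j <> i :> nat by move=> ?; apply: ji; apply: val_inj.
    by rewrite /a'; case: ifP => ?; lia.
  - by move=> j; have := ltn_ord j; rewrite /a'; case: ifP => ?; lia.
rewrite (a'T i) // T_first //.
move=> j /eqP ji; have {}ji : j <> i :> nat by move=> ?; apply: ji; apply: val_inj.
by have := ltn_ord j; rewrite /a'; case: ifP => ?; lia.
Qed.

End Invariance.

(** The cochains are exchanged one at a time: the sum of [e i] and [e' i] is invariant under
    antipodes, so each exchange adds a vanishing sum. *)
Lemma cup_twisted e e' : twisted e -> twisted e' -> cup e = cup e'.
Proof.
move=> te te'; pose f k (i : 'I_n) := if i < k then e' i else e i.
have tf k : twisted (f k) by move=> i B x bx; rewrite /f; case: ifP => _; auto.
have step k : k <= n -> cup e = cup (f k).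
  elim: k => [|k IH] kn; first by congr cup.
  rewrite IH; last by lia.
  apply/eqP; rewrite -subr_eq0; apply/eqP; rewrite /cup -sumrB.
  pose i := Ordinal kn; pose h x := e i x (+) e' i x.
  have tf' j : j != i -> forall B x, bd B x ->
      f k j (neg B x) = f k j x (+) chi j B by move=> _; exact: tf.
  rewrite -[RHS](@cup_coboundary (f k) h i tf').
    apply: eq_bigr => t _; rewrite (bigD1 i) //= [X in (_ - X)%R](bigD1 i) //=.
    rewrite [X in (_ - _ * X)%R](eq_bigr
      (fun j => (f k j (vert t j) + f k j (vert t j.+1))%R)); last first.
      move=> j /eqP ji; have {}ji : j <> k :> nat by move=> ?; apply: ji; apply: val_inj.
      by rewrite /f ltnS leq_eqVlt; case: eqP.
    rewrite /f /= ltnn ltnS leqnn /h.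
    set X := (\prod_(_ < _ | _) _)%R.
    by case: (e _ _) (e' _ _) (e _ _) (e' _ _) X => [] [] [] [] [].
  by move=> B x bx; rewrite /h te // te' //; case: (e _ _) (e' _ _) (chi _ _) => [] [] [].
rewrite (step n) //; congr cup; apply: funext => j; by rewrite /f ltn_ord.
Qed.

(** * Standard cochains *)

Definition first B (x : vtx) (d0 : 'I_n) :=
  [&& blk d0 == B, onbd (x d0) &
    [forall d : 'I_n, (d < d0) && (blk d == B) ==> ~~ onbd (x d)]].

(* With this choice of cochains a single simplex contributes to [cup]. *)
Definition std B (x : vtx) := [exists d, first B x d && (x d == m.*2)].

Lemma firstP B x d0 : reflect
  [/\ blk d0 = B, onbd (x d0) &
      forall d : 'I_n, d < d0 -> blk d = B -> ~~ onbd (x d)] (first B x d0).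
Proof.
apply: (iffP and3P) => -[].
  move=> /eqP ? ? /forallP h; split=> // d dd0 bB.
  by have := h d; rewrite dd0 bB eqxx.
move=> /eqP ? ? h; split=> //; apply/forallP => d.
by apply/implyP => /andP[? /eqP ?]; exact: h.
Qed.

Lemma std_first B x d0 : first B x d0 -> std B x = (x d0 == m.*2).
Proof.
move=> f0; apply/existsP/idP => [[d /andP[fd xd]]|xd]; last by exists d0; rewrite f0.
suff -> : d0 = d by [].
have [bd0 od0 hd0] := firstP _ _ _ f0; have [bd1 od hd] := firstP _ _ _ fd.
have [dd|dd|/val_inj //] := ltngtP d0 d.
- by have := hd _ dd bd0; rewrite od0.
- by have := hd0 _ dd bd1; rewrite od.
Qed.

Lemma std_none B x : (forall d, blk d = B -> ~~ onbd (x d)) -> std B x = false.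
Proof.
move=> h; apply/existsP => -[d /andP[/firstP[bd0 od _] _]].
by have := h _ bd0; rewrite od.
Qed.

Lemma exists_first B x : {d0 | first B x d0} + {forall d, blk d = B -> ~~ onbd (x d)}.
Proof.
case: (pickP (fun d => (blk d == B) && onbd (x d))) => [d0 Pd0|no]; last first.
  by right=> d bB; have := no d; rewrite bB eqxx /= => ->.
left; case: (@arg_minnP _ d0 (fun d => (blk d == B) && onbd (x d))
  (fun d : 'I_n => d : nat) Pd0) => d /andP[/eqP bB od] dmin.
exists d; apply/firstP; split=> // d' dd' bB'; apply/negP => od'.
by have := dmin d'; rewrite bB' eqxx od' => /(_ isT); lia.
Qed.

(** The antipode preserves the set of boundary coordinates of [B], hence the first of them, and
    exchanges its values 0 and [m.*2]. *)
Lemma std_neg_same B x : 0 < m -> bd B x -> std B (neg B x) = ~~ std B x.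
Proof.
move=> m0 /andP[/forallP xm /existsP[d1 /andP[/eqP b1 o1]]].
have [[d0 f0]|no] := exists_first B x; last by have := no _ b1; rewrite o1.
rewrite (std_first f0); have [bd0 od0 hd0] := firstP _ _ _ f0.
have onbdN d : onbd (m.*2 - x d) = onbd (x d).
  by have := xm d; rewrite /onbd; lia.
have -> : std B (neg B x) = (neg B x d0 == m.*2).
  apply: std_first; apply/firstP; split=> //.
    by rewrite /neg bd0 eqxx onbdN.
  by move=> d dd bB; rewrite /neg bB eqxx onbdN hd0.
by rewrite /neg bd0 eqxx; have := xm d0; move: od0; rewrite /onbd; lia.
Qed.

Lemma std_eq B (x y : vtx) : (forall d, blk d = B -> x d = y d) -> std B x = std B y.
Proof.
move=> xy; have [[d0 f0]|no] := exists_first B x.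
  have [bd0 od0 hd0] := firstP _ _ _ f0.
  rewrite (std_first f0) xy //; symmetry; apply: std_first.
  apply/firstP; split => // [|d dd bB]; first by rewrite -xy.
  by rewrite -xy // hd0.
by rewrite !std_none // => d bB; rewrite -?xy // no.
Qed.

Definition std_chi (i : 'I_n) (x : vtx) : bool := (\sum_(B | chi i B) std B x)%R.

Lemma std_chi_twisted : 0 < m -> twisted std_chi.
Proof.
move=> m0 i B x bx; rewrite /std_chi.
have neq C : C != B -> std C (neg B x) = std C x.
  move=> CB; apply: std_eq => d bC; rewrite /neg bC; by rewrite (negbTE CB).
case: (boolP (chi i B)) => cB.
  rewrite (bigD1 B) //= [in RHS](bigD1 B) //= std_neg_same //.
  rewrite (eq_bigr (std^~ x)); last by move=> C /andP[_]; exact: neq.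
  by case: (std B x) (\sum_(_ | _) _)%R => [] [].
rewrite addbF; apply: eq_bigr => C cC; apply: neq.
by apply: contraNneq cB => <-.
Qed.

Lemma vertE_moved (t : smplx) (i : 'I_n) : vert t i.+1 (t.2 i) = hi (t.1 (t.2 i)).
Proof. by rewrite /vert permK ltnSn. Qed.

Lemma vertE_start (t : smplx) (i : 'I_n) : vert t i (t.2 i) = lo (t.1 (t.2 i)).
Proof. by rewrite /vert permK ltnn. Qed.

Lemma vertE_other (t : smplx) (i : 'I_n) d : d != t.2 i -> vert t i.+1 d = vert t i d.
Proof.
move=> di; rewrite /vert ltnS leq_eqVlt; case: eqP => //= /val_inj di'.
by rewrite -di' permKV eqxx in di.
Qed.

Lemma onbd_hi a : onbd (hi a) = false.
Proof. by rewrite /onbd /hi; case: ifP => ?; lia. Qed.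

Lemma std_chi_step (t : smplx) (i : 'I_n) (B := blk (t.2 i)) :
  std_chi i (vert t i) (+) std_chi i (vert t i.+1) =
  chi i B && (std B (vert t i) (+) std B (vert t i.+1)).
Proof.
rewrite /std_chi.
have eqC C : C != B -> std C (vert t i.+1) = std C (vert t i).
  move=> CB; apply: std_eq => d bC; apply: vertE_other.
  by apply: contraNneq CB => di; rewrite -bC di.
case: (boolP (chi i B)) => cB.
  rewrite (bigD1 B) //= [in X in _ (+) X](bigD1 B) //=.
  rewrite [X in _ (+) (_ + X)%R](eq_bigr (std^~ (vert t i))); last first.
    by move=> C /andP[_]; exact: eqC.
  by case: (std B _) (std B _) (\sum_(_ | _) _)%R => [] [] [].
rewrite (eq_bigr (std^~ (vert t i.+1))); first exact: addbb.
by move=> C cC; rewrite eqC //; apply: contraNneq cB => <-.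
Qed.

(** Odd ends are interior, so a move can only take a coordinate off the boundary; if this is not the
    first boundary coordinate of [B], the value of [std] is kept. *)
Lemma std_step_first (t : smplx) (i : 'I_n) (B := blk (t.2 i)) :
  std B (vert t i) != std B (vert t i.+1) -> first B (vert t i) (t.2 i).
Proof.
have [[d0 f0]|no] := exists_first B (vert t i).
  case: (eqVneq d0 (t.2 i)) => [<- //|d0i].
  have [b0 o0 h0] := firstP _ _ _ f0.
  have -> : std B (vert t i.+1) = (vert t i.+1 d0 == m.*2).
    apply: std_first; apply/firstP; rewrite vertE_other //; split => // d dd bB.
    case: (eqVneq d (t.2 i)) => [->|di]; first by rewrite vertE_moved onbd_hi.
    by rewrite vertE_other // h0.
  by rewrite (std_first f0) vertE_other // eqxx.
rewrite (std_none no) std_none // => d bB.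
case: (eqVneq d (t.2 i)) => [->|di]; first by rewrite vertE_moved onbd_hi.
by rewrite vertE_other // no.
Qed.

(** * The single contributing simplex *)

Section Count.
Hypothesis m_gt0 : 0 < m.
Hypothesis chi_diag : forall i, chi i (blk i).
(** Once the coordinates before [i] are used up, the block of [i] is the only one with a coordinate
    left in which equation [i] is odd; this forces the order of the moves. *)
Hypothesis chi_min : forall i d : 'I_n, i <= d ->
  (forall d' : 'I_n, i <= d' -> blk d' = blk d -> d <= d') -> chi i (blk d) -> d = i.

(** The value of [std B] at vertex [k] of the contributing simplex: it is false at vertex [n], where
    all coordinates are interior, and changes at each move in [B]. *)
Let par B (k : nat) := odd #|[pred d : 'I_n | (k <= d) && (blk d == B)]|.

Let parS B (i : 'I_n) : par B i = (blk i == B) (+) par B i.+1.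
Proof.
rewrite /par (cardD1 i) inE leqnn /= oddD oddb; congr (_ (+) odd _).
apply: eq_card => d; rewrite !inE; case: (eqVneq d i) => [->|di] /=; first by rewrite ltnn.
by rewrite [i <= d]leq_eqVlt; case: eqP => // /val_inj /eqP; rewrite eq_sym (negbTE di).
Qed.

Let par_n B : par B n = false.
Proof.
by rewrite /par eq_card0 // => d; rewrite !inE leqNgt ltn_ord.
Qed.

Let bot_lt : 0 < m.*2. Proof. by lia. Qed.
Let top_lt : m.*2.-1 < m.*2. Proof. by lia. Qed.
Let bot : 'I_(m.*2) := Ordinal bot_lt.
Let top : 'I_(m.*2) := Ordinal top_lt.

Let t0 : smplx := ([ffun d : 'I_n => if par (blk d) d then top else bot], 1%g).

Let alternating (t : smplx) := [forall i : 'I_n, chi i (blk (t.2 i)) &&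
  (std (blk (t.2 i)) (vert t i) (+) std (blk (t.2 i)) (vert t i.+1))].

Let std_vert_n B (t : smplx) : std B (vert t n) = false.
Proof. by apply: std_none => d _; rewrite /vert ltn_ord onbd_hi. Qed.

Let lo_cases (a : 'I_(m.*2)) : onbd (lo a) -> a = if lo a == m.*2 then top else bot.
Proof.
move=> oa; apply: val_inj; have := ltn_ord a; move: oa; rewrite /onbd /lo.
by case: ifP => o1 /orP[] /eqP e al; case: eqP => e' /=; lia.
Qed.

Let lo_t0 d : lo (t0.1 d) = if par (blk d) d then m.*2 else 0.
Proof.
rewrite /t0 /= ffunE; case: ifP => _ //=; rewrite /lo.
by case: ifP => ?; lia.
Qed.

Let std_t0 B k : k <= n -> std B (vert t0 k) = par B k.
Proof.
move=> kn; rewrite -(subKn kn); elim: (n - k) (leq_subr k n) => [|j IH] jn.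
  by rewrite subn0 std_vert_n par_n.
have jn' : n - j.+1 < n by lia.
pose i := Ordinal jn'.
have {}IH : std B (vert t0 i.+1) = par B i.+1.
  by rewrite /= subnSK //; apply: IH; lia.
rewrite -[n - j.+1]/(val i) parS; case: eqP => bB.
  have lo_i : vert t0 i i = lo (t0.1 i) by rewrite /vert invg1 perm1 ltnn.
  rewrite (@std_first _ _ i).
    rewrite lo_i lo_t0 bB parS bB eqxx; case: (true (+) _) => //; first by rewrite eqxx.
    by apply/eqP; lia.
  apply/firstP; split => //.
    by rewrite lo_i lo_t0 /onbd; case: ifP => _; rewrite eqxx ?orbT.
  by move=> d di _; rewrite /vert /= invg1 perm1 di onbd_hi.
rewrite -IH; apply: std_eq => d dB; rewrite vertE_other // perm1.
by apply/eqP => di; apply: bB; rewrite -di.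
Qed.

Let alternating_t0 : alternating t0.
Proof.
apply/forallP => i; rewrite perm1 chi_diag !std_t0 //; last exact: ltnW.
by rewrite parS eqxx; case: (par _ _).
Qed.

(** Each move must take the first boundary coordinate of its block, so within a block coordinates
    move in increasing order; [chi_min] fixes the interleaving, and the values of [std], read back
    from vertex [n], fix the ends. *)
Let alternating_unique (t : smplx) : alternating t -> t = t0.
Proof.
move=> /forallP alt.
have H1 i : chi i (blk (t.2 i)) by have /andP[] := alt i.
have H1' i : first (blk (t.2 i)) (vert t i) (t.2 i).
  apply: std_step_first; have /andP[_] := alt i.
  by case: (std _ _); case: (std _ _).
have H2 d : onbd (lo (t.1 d)).
  have /firstP[_ + _] := H1' (t.2^-1 d)%g.
  by rewrite vertE_start permKV.
have H3 i (d : 'I_n) : d < t.2 i -> blk d = blk (t.2 i) -> (t.2^-1)%g d < i.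
  move=> di db; have /firstP[_ _ h] := H1' i.
  have := h _ di db; rewrite /vert; case: ifP => // _.
  by rewrite H2.
(* By strong induction the coordinates below [i] are used already, so [t.2 i] is at least [i] and is
   the least coordinate left in its block. *)
have H4 i : t.2 i = i.
  have [k] := ubnP (i : nat); elim: k i => // k IH i ik.
  apply: chi_min => //.
  - rewrite leqNgt; apply/negP => h.
    have /perm_inj e : t.2 (t.2 i) = t.2 i by apply: IH; lia.
    by rewrite e ltnn in h.
  - move=> d id db; rewrite leqNgt; apply/negP => h.
    have hd := H3 _ _ h db.
    have : t.2 (t.2^-1 d)%g = (t.2^-1 d)%g by apply: IH; lia.
    by rewrite permKV => e; rewrite -e in hd; lia.
have t2 : t.2 = 1%g by apply/permP => i; rewrite H4 perm1.
have H5 B k : k <= n -> std B (vert t k) = par B k.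
  move=> kn; rewrite -(subKn kn); elim: (n - k) (leq_subr k n) => [|j IH] jn.
    by rewrite subn0 std_vert_n par_n.
  have jn' : n - j.+1 < n by lia.
  pose i := Ordinal jn'.
  have {}IH : std B (vert t i.+1) = par B i.+1.
    by rewrite /= subnSK //; apply: IH; lia.
  rewrite -[n - j.+1]/(val i) parS -IH; case: eqP => bB.
    by have /andP[_] := alt i; rewrite H4 bB; case: (std _ _); case: (std _ _).
  apply: std_eq => d dB; rewrite vertE_other // H4.
  by apply/eqP => di; apply: bB; rewrite -di.
rewrite [t]surjective_pairing t2 /t0; congr pair; apply/ffunP => d.
rewrite ffunE (lo_cases (H2 d)) -H5; last exact: ltnW.
have := H1' d; rewrite H4 => /std_first ->.
by have -> : vert t d d = lo (t.1 d) by rewrite /vert t2 invg1 perm1 ltnn.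
Qed.

Lemma cup_std : cup std_chi = true.
Proof.
rewrite /cup (bigD1 t0) //= [X in (_ + X)%R]big1.
  rewrite addr0 big1 // => i _; rewrite -[LHS]/(_ (+) _) std_chi_step.
  by have /forallP /(_ i) := alternating_t0.
move=> t tt0; have : ~~ alternating t.
  by apply: contraNN tt0 => /alternating_unique ->.
rewrite negb_forall => /existsP[i]; rewrite -std_chi_step => hi.
by rewrite (bigD1 i) //= -[X in (X * _)%R]/(_ (+) _) (negbTE hi) mul0r.
Qed.

End Count.

(** The cup product equals that of the standard cochains, which is 1, so on some simplex all factors
    are 1. *)
Lemma alternating_simplex e : 0 < m -> (forall i, chi i (blk i)) ->
  (forall i d : 'I_n, i <= d -> 
    (forall d' : 'I_n, i <= d' -> blk d' = blk d -> d <= d') -> chi i (blk d) -> d = i) ->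
  twisted e ->
  exists t : smplx, forall i : 'I_n, e i (vert t i) != e i (vert t i.+1).
Proof.
move=> m0 c1 c2 te; have := cup_std m0 c1 c2.
rewrite (cup_twisted (std_chi_twisted m0) te) => /eqP.
have [/existsP[t /forallP ht]|] := boolP
    [exists t : smplx, [forall i : 'I_n, e i (vert t i) != e i (vert t i.+1)]].
  by exists t.
rewrite negb_exists => /forallP no; rewrite /cup big1 // => t _.
have := no t; rewrite negb_forall => /existsP[i]; rewrite negbK => /eqP ei.
by rewrite (bigD1 i) //= ei -[X in (X * _)%R]/(_ (+) _) addbb mul0r.
Qed.

End Grid.

(** * Common zeros of odd functions on a cube *)

Local Open Scope classical_set_scope.
Local Open Scope ring_scope.

Section CubeZero.
Context (R : realType) (n : nat) (K : finType) (blk : 'I_n.+1 -> K)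
  (chi : 'I_n.+1 -> pred K).

Definition neg_row (B : K) (x : 'rV[R]_n.+1) : 'rV[R]_n.+1 :=
  \row_d if blk d == B then - x 0 d else x 0 d.

Let pt (m : nat) (p : 'I_n.+1 -> nat) : 'rV[R]_n.+1 :=
  \row_d ((p d)%:R / m%:R - 1).

Let pt_neg m B p : (0 < m)%N -> (forall d, (p d <= m.*2)%N) ->
  pt m (neg m blk B p) = neg_row B (pt m p).
Proof.
move=> m0 pm; apply/rowP => d; rewrite !mxE /neg; case: eqP => // _.
have m0' : (m%:R : R) != 0 by rewrite pnatr_eq0; lia.
rewrite natrB // -addnn natrD mulrBl mulrDl divff //; lra.
Qed.

Let pt_le m p d : (0 < m)%N -> (p d <= m.*2)%N -> `|pt m p 0 d| <= 1.
Proof.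
move=> m0 pm; rewrite mxE ler_norml.
have m0' : (0 : R) < m%:R by rewrite ltr0n.
apply/andP; split; first by rewrite lerBrDl addrN divr_ge0.
by rewrite lerBlDr ler_pdivrMr // -[1 + 1]/(2%:R) -natrM ler_nat; lia.
Qed.

Let pt_bd m p d : (0 < m)%N -> onbd m (p d) -> `|pt m p 0 d| = 1.
Proof.
move=> m0; rewrite mxE; have m0' : (m%:R : R) != 0 by rewrite pnatr_eq0; lia.
case/orP => /eqP ->; first by rewrite mul0r sub0r normrN1.
by rewrite -addnn natrD mulrDl divff // addrK normr1.
Qed.

Let pt_close m (t : {ffun 'I_n.+1 -> 'I_m.*2} * {perm 'I_n.+1}) k d :
  (0 < m)%N -> `|pt m (vert t 0) 0 d - pt m (vert t k) 0 d| <= m%:R^-1.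
Proof.
move=> m0; rewrite !mxE opprB addrA subrK -mulrBl normrM.
have m0' : (0 : R) < m%:R by rewrite ltr0n.
have m1 : (0 : R) <= m%:R^-1 by rewrite invr_ge0 ltW.
rewrite [X in _ * X]ger0_norm // ler_piMl //.
rewrite /vert ltn0; case: ifP => _; rewrite ?subrr ?normr0 //.
rewrite /lo /hi; case: ifP => _; rewrite -natr1.
  by rewrite addrAC subrr add0r normr1.
by rewrite opprD addrA subrr add0r normrN1.
Qed.

(** Without a common zero, alternating simplices on ever finer grids accumulate at a point; some
    function keeps its sign near that point, against the alternation on a small simplex nearby. *)
Theorem cube_common_zero (f : 'I_n.+1 -> 'rV[R]_n.+1 -> R) :
  (forall i, chi i (blk i)) ->
  (forall i d : 'I_n.+1, (i <= d)%N ->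
    (forall d' : 'I_n.+1, (i <= d')%N -> blk d' = blk d -> (d <= d')%N) ->
    chi i (blk d) -> d = i) ->
  (forall i, continuous (f i)) ->
  (forall i B (x : 'rV[R]_n.+1), (forall d, `|x 0 d| <= 1) ->
     (exists2 d, blk d = B & `|x 0 d| = 1) ->
     f i (neg_row B x) = (-1) ^+ (chi i B) * f i x) ->
  exists x, forall i, f i x = 0.
Proof.
move=> chi_diag chi_min fc fodd.
apply: contrapT => nozero.
have nz x : exists i, f i x != 0.
  apply: contrapT => h; apply: nozero; exists x => i.
  by apply/eqP; apply: contrapT => /negP h'; apply: h; exists i.
(* Ties at zeros of [f i] are broken by the standard cochain, which has the required symmetry. *)
pose e m i p := if f i (pt m p) == 0 then std_chi m blk chi i p else 0 < f i (pt m p).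
have tw m : (0 < m)%N -> twisted m blk chi (e m).
  move=> m0 i B p bp; have /andP[/forallP pm /existsP[d /andP[/eqP dB od]]] := bp.
  have -> : e m i (neg m blk B p) = if f i (pt m p) == 0
     then std_chi m blk chi i (neg m blk B p)
     else 0 < (-1) ^+ (chi i B) * f i (pt m p).
    rewrite /e pt_neg // fodd ?mulrI_eq0 //; last first.
    - by exists d => //; exact: pt_bd.
    - by move=> d'; exact: pt_le.
    - by apply: lregX; apply: lregN; exact: lreg1.
  rewrite /e; case: ifPn => f0; first exact: std_chi_twisted.
  case: (chi i B); rewrite ?expr0 ?mul1r ?addbF // expr1 mulN1r oppr_gt0.
  by rewrite addbT -leNgt lt_neqAle f0.
have simplex m : exists t : {ffun 'I_n.+1 -> 'I_m.+1.*2} * {perm 'I_n.+1},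
    forall i : 'I_n.+1, e m.+1 i (vert t i) != e m.+1 i (vert t i.+1).
  exact: alternating_simplex (tw m.+1 _).
pose t m := sval (cid (simplex m)); have ht m := svalP (cid (simplex m)).
pose u m := pt m.+1 (vert (t m) 0).
pose C := [set x : 'rV[R]_n.+1 | forall d, `[-1, 1]%classic (x 0 d)].
have Cc : compact C.
  exact: (@rV_compact R n.+1 (fun=> `[-1, 1]%classic) (fun=> @segment_compact R (-1) 1)).
have uC : (u @ \oo) C.
  exists 0%N => // m _ d /=.
  by rewrite in_itv /= -ler_norml; apply: pt_le => //; exact: vert_le.
have [x [_ xu]] := Cc _ _ uC.
have [i fx] := nz x.
have [r r0 hr] : exists2 r : R, 0 < r &
    forall y, ball x r y -> (f i y != 0) /\ (0 < f i y) = (0 < f i x).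
  have : \forall y \near x, `|f i x - f i y| < `|f i x|.
    by move/cvgrPdist_lt: (fc i x); apply; rewrite normr_gt0.
  move=> /nbhs_ballP[r /= r0 hr]; exists r => // y /hr /=.
  case: (ltgtP (f i x) 0) fx => // f0 _.
    by rewrite ltr_norml (ltr0_norm f0) => ?; split; [apply/eqP|apply/negP]; lra.
  rewrite ltr_norml (gtr0_norm f0) => ?; split; first by apply/eqP; lra.
  by lra.
have r2 : 0 < r / 2 by rewrite divr_gt0.
have [N _ hN] : \forall m \near \oo, (m.+1%:R^-1 : R) < r / 2.
  exact: near_infty_natSinv_lt (PosNum r2).
have [_ [[m mN <-] um]] : (u @` [set m | (N <= m)%N]) `&` ball x (r / 2) !=set0.
  apply: xu; last exact: nbhsx_ballx.
  by exists N => // m; exists m.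
have inball k : ball x r (pt m.+1 (vert (t m) k)).
  rewrite (splitr r); apply: (ball_triangle um); split=> // a d; rewrite (ord1 a).
  by apply: le_lt_trans (hN _ mN); exact: pt_close.
have := ht m i; rewrite /e.
have [/negPf -> ->] := hr _ (inball i); have [/negPf -> ->] := hr _ (inball i.+1).
by rewrite eqxx.
Qed.

End CubeZero.

(** * Masses of half-spaces *)

Lemma measurable_prod_affine d (T : measurableType d) (R : realType)
    (g : T -> measurableTypeR R) (a : R) : measurable_fun setT g ->
  measurable_fun setT
    (fun x : T * measurableTypeR R => g x.1 + a * x.2 : measurableTypeR R).
Proof.
move=> mg; apply: measurable_funD; first exact: measurableT_comp.
by apply: measurable_funM => //; exact: measurable_snd.
Qed.

(** If [a != 0], every section over the first factor is a single point; otherwise the set is a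
    cylinder over a null set. *)
Lemma product_lebesgue_null d (T : measurableType d) (R : realType)
    (m : {measure set T -> \bar R}) (g : T -> measurableTypeR R) (a u : R) :
  measurable_fun setT g -> a != 0 \/ m [set y | g y = u] = 0 ->
  (m \x @lebesgue_measure R)%E
    [set x : T * measurableTypeR R | g x.1 + a * x.2 = u] = 0.
Proof.
move=> mg; have [-> [//|null]|a0 _] := eqVneq a 0.
  have -> : [set x : T * measurableTypeR R | g x.1 + 0 * x.2 = u] =
      [set y | g y = u] `*` setT.
    by apply/seteqP; split=> x /=; rewrite mul0r addr0 // => -[].
  rewrite product_measure1E //.
    by move: null => /= ->; rewrite mul0e.
  by rewrite -[X in measurable X]setTI; apply: (mg measurableT [set u]).
rewrite /= /product_measure1 (eq_integral (cst 0%E)) ?integral0 // => y _ /=.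
rewrite [X in lebesgue_measure X](_ : _ = [set (u - g y) / a]).
  by rewrite lebesgue_measure_set1.
apply/seteqP; split => z; rewrite /xsection /= inE /=.
  by move=> <-; rewrite addrC addKr mulrC mulKf.
by move=> ->; rewrite mulrC divfK // addrC subrK.
Qed.

Section Measure.
Context (R : realType).

Local Notation X := (borel4 R).

Lemma dot40 (x : space4 R) : dot4 0 x = 0.
Proof.
by rewrite -[LHS]/(0 * x.1.1.1 + 0 * x.1.1.2 + 0 * x.1.2 + 0 * x.2) !mul0r !addr0.
Qed.

Lemma dot4_self_gt0 (a : space4 R) : a != 0 -> 0 < dot4 a a.
Proof.
case: a => [[[a1 a2] a3] a4] a0; rewrite /dot4 /= -!expr2 lt_neqAle.
rewrite !addr_ge0 ?sqr_ge0 // andbT eq_sym; apply: contraNneq a0 => h.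
have [[[h1 h2] h3] h4] : ((a1 = 0 /\ a2 = 0) /\ a3 = 0) /\ a4 = 0.
  have := sqr_ge0 a1; have := sqr_ge0 a2; have := sqr_ge0 a3; have := sqr_ge0 a4.
  by move=> ? ? ? ?; do ! split; apply/eqP; rewrite -sqrf_eq0 eq_le sqr_ge0 andbT; lra.
by rewrite h1 h2 h3 h4.
Qed.

Lemma dot4Z (a : space4 R) (k : R) x : dot4 a (k *: x) = k * dot4 a x.
Proof.
rewrite -[LHS]/(a.1.1.1 * (k * x.1.1.1) + a.1.1.2 * (k * x.1.1.2) +
  a.1.2 * (k * x.1.2) + a.2 * (k * x.2)) /dot4; ring.
Qed.

Lemma dot4D (a x y : space4 R) : dot4 a (x + y) = dot4 a x + dot4 a y.
Proof.
rewrite -[LHS]/(a.1.1.1 * (x.1.1.1 + y.1.1.1) + a.1.1.2 * (x.1.1.2 + y.1.1.2) +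
  a.1.2 * (x.1.2 + y.1.2) + a.2 * (x.2 + y.2)) /dot4; ring.
Qed.

Lemma continuous_dot4 (T : topologicalType) (t0 : T) (a x : T -> space4 R) :
  a t @[t --> t0] --> a t0 -> x t @[t --> t0] --> x t0 ->
  dot4 (a t) (x t) @[t --> t0] --> dot4 (a t0) (x t0).
Proof.
move=> ca cx.
have c1 (U V : topologicalType) (f : T -> U * V) : f t @[t --> t0] --> f t0 ->
    (f t).1 @[t --> t0] --> (f t0).1.
  move=> cf; apply: (@cvg_comp _ _ _ f fst (nbhs t0) (nbhs (f t0)) _ cf).
    exact: (@cvg_fst _ _ (nbhs (f t0).1) (nbhs (f t0).2)).
have c2 (U V : topologicalType) (f : T -> U * V) : f t @[t --> t0] --> f t0 ->
    (f t).2 @[t --> t0] --> (f t0).2.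
  move=> cf; apply: (@cvg_comp _ _ _ f snd (nbhs t0) (nbhs (f t0)) _ cf).
    exact: (@cvg_snd _ _ (nbhs (f t0).1) (nbhs (f t0).2)).
have [a1 a2] := (c1 _ _ _ ca, c2 _ _ _ ca); have [x1 x2] := (c1 _ _ _ cx, c2 _ _ _ cx).
have [a3 a4] := (c1 _ _ _ a1, c2 _ _ _ a1); have [x3 x4] := (c1 _ _ _ x1, c2 _ _ _ x1).
have [a5 a6] := (c1 _ _ _ a3, c2 _ _ _ a3); have [x5 x6] := (c1 _ _ _ x3, c2 _ _ _ x3).
exact: cvgD (cvgD (cvgD (cvgM a5 x5) (cvgM a6 x6)) (cvgM a4 x4)) (cvgM a2 x2).
Qed.

Lemma measurable_dot4 (a : space4 R) :
  measurable_fun [set: X] (dot4 a : X -> measurableTypeR R).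
Proof.
case: a => [[[a1 a2] a3] a4]; rewrite /dot4 /=.
have m1 : measurable_fun setT (fun x : measurableTypeR R => a1 * x : measurableTypeR R).
  exact: measurable_funM.
exact: (measurable_prod_affine a4 (measurable_prod_affine a3 (measurable_prod_affine a2 m1))).
Qed.

Lemma lebesgue4_hyperplane (a : space4 R) (u : R) :
  a != 0 -> lebesgue4 (hyperplane a u) = 0%E.
Proof.
case: a => [[[a1 a2] a3] a4] a0; rewrite /hyperplane /dot4 /=.
have mf (c : R) : measurable_fun setT (fun x : measurableTypeR R => c * x : measurableTypeR R).
  exact: measurable_funM.
apply: (@product_lebesgue_null _ _ _ _
  (fun x : measurableTypeR R * measurableTypeR R * measurableTypeR R =>
     a1 * x.1.1 + a2 * x.1.2 + a3 * x.2 : measurableTypeR R)).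
  exact: (measurable_prod_affine a3 (measurable_prod_affine a2 (mf a1))).
have [a4E|] := eqVneq a4 0; [right|by left].
apply: (@product_lebesgue_null _ _ _ _
  (fun x : measurableTypeR R * measurableTypeR R =>
     a1 * x.1 + a2 * x.2 : measurableTypeR R)).
  exact: (measurable_prod_affine a2 (mf a1)).
have [a3E|] := eqVneq a3 0; [right|by left].
apply: (@product_lebesgue_null _ _ _ _
  (fun x : measurableTypeR R => a1 * x : measurableTypeR R)) => //.
have [a2E|] := eqVneq a2 0; [right|by left].
have a1N0 : a1 != 0.
  by apply: contraNneq a0 => ->; rewrite a2E a3E a4E.
rewrite (_ : [set y : measurableTypeR R | a1 * y = u] = [set u / a1]).
  exact: lebesgue_measure_set1.
apply/seteqP; split => z /=; first by move=> <-; rewrite mulrC mulKf.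
by move=> ->; rewrite mulrC divfK.
Qed.

Lemma measurable_halfspace (a : space4 R) (s : R) j :
  measurable (halfspace a s j : set X).
Proof.
have -> : halfspace a s j = setT `&` (dot4 a : X -> measurableTypeR R) @^-1`
    [set` (if j then `[s, +oo[ else `]-oo, s] : interval R)].
  by rewrite setTI; case: j; apply/seteqP; split => x /=; rewrite in_itv /= ?andbT.
by apply: measurable_dot4 => //; case: j; exact: measurable_itv.
Qed.

Lemma halfspaceN (a : space4 R) (s : R) j :
  halfspace (- a) (- s) j = halfspace a s (~~ j).
Proof.
have dotN x : dot4 (- a) x = - dot4 a x by rewrite /dot4 /=; ring.
by case: j; apply/seteqP; split => x /=; rewrite dotN lerN2.
Qed.

End Measure.

(** * Continuity of masses *)

Section MassDistribution.
Context (R : realType) (mu : {finite_measure set (borel4 R) -> \bar R}).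
Hypothesis hmu : mass_distribution mu.

Local Notation X := (borel4 R).
Implicit Types A B : set X.

Definition mass A : R := fine (mu A).

Lemma massE A : measurable A -> mu A = (mass A)%:E.
Proof. by move=> mA; rewrite /mass fineK // fin_num_measure. Qed.

Lemma mass_ge0 A : 0 <= mass A.
Proof. by apply: fine_ge0; exact: measure_ge0. Qed.

Lemma le_mass A B : measurable A -> measurable B -> A `<=` B -> mass A <= mass B.
Proof.
move=> mA mB AB; rewrite -lee_fin -!massE //.
by apply: le_measure => //; rewrite inE.
Qed.

Lemma mass_split A B : measurable A -> measurable B ->
  mass A = mass (A `&` B) + mass (A `\` B).
Proof.
move=> mA mB; apply: EFin_inj; rewrite EFinD -!massE //.
- by rewrite addeC; exact: measureDI.
- exact: measurableD.
- exact: measurableI.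
Qed.

Lemma mass_dist A B : measurable A -> measurable B ->
  `|mass A - mass B| <= mass (A `+` B).
Proof.
move=> mA mB; have mAB : measurable (A `\` B) by exact: measurableD.
have mBA : measurable (B `\` A) by exact: measurableD.
have mY : measurable (A `+` B) by exact: measurableU.
have h1 := mass_split mA mB; have h2 := mass_split mB mA.
rewrite setIC in h2.
have l1 : mass (A `\` B) <= mass (A `+` B) by apply: le_mass => // x; left.
have l2 : mass (B `\` A) <= mass (A `+` B) by apply: le_mass => // x; right.
have := mass_ge0 (A `\` B); have := mass_ge0 (B `\` A).
by move=> ? ?; rewrite ler_norml; apply/andP; split; lra.
Qed.

Lemma mass_subU A B C : measurable A -> measurable B -> measurable C ->
  C `<=` A `|` B -> mass C <= mass A + mass B.
Proof.
move=> mA mB mC CAB; rewrite -lee_fin EFinD -!massE //.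
apply: (le_trans _ (measureU2 _ mA mB)).
by apply: le_measure => //; rewrite inE //; exact: measurableU.
Qed.

Lemma measurable_hyperplane (a : space4 R) (u : R) :
  measurable (hyperplane a u : set X).
Proof.
rewrite -[X in measurable X]setTI.
by apply: (@measurable_dot4 R a measurableT [set u]).
Qed.

(** A zero normal with nonzero offset gives the empty set; this degenerate case occurs because the
    pairs of normal and offset range over a whole sphere. *)
Lemma mass_hyperplane (a : space4 R) (u : R) :
  a != 0 \/ u != 0 -> mass (hyperplane a u) = 0.
Proof.
have [-> [//|u0]|a0 _] := eqVneq a 0.
  rewrite (_ : hyperplane 0 u = set0) /mass ?measure0 //.
  apply/seteqP; split => // x; rewrite /hyperplane /= dot40 => /eqP.
  by rewrite eq_sym (negbTE u0).
have [[f [fi muE]] _] := hmu.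
have mH := measurable_hyperplane a u.
rewrite /mass muE // null_set_integral //.
- apply: measurable_funS (measurableT) _ _ => //.
  by have /integrableP[] := fi.
- exact: lebesgue4_hyperplane.
Qed.

Lemma mass_setT_gt0 : 0 < mass setT.
Proof.
have [_ /(_ setT)] := hmu; rewrite (massE measurableT) lte_fin; apply.
  exact: openT.
by exists 0.
Qed.

(** Continuity for the pseudometric given by the mass of the symmetric difference; unlike continuity
    of the mass, it passes to intersections. *)
Definition mass_continuous_at (T : topologicalType) (A : T -> set X) (t0 : T) :=
  forall e, 0 < e -> \forall t \near t0, mass (A t `+` A t0) < e.

Lemma mass_continuousI (T : topologicalType) (A B : T -> set X) (t0 : T) :
  (forall t, measurable (A t)) -> (forall t, measurable (B t)) ->
  mass_continuous_at A t0 -> mass_continuous_at B t0 ->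
  mass_continuous_at (fun t => A t `&` B t) t0.
Proof.
move=> mA mB cA cB e e0; have e2 : 0 < e / 2 by rewrite divr_gt0.
near=> t; have Ae : mass (A t `+` A t0) < e / 2 by near: t; exact: cA.
have Be : mass (B t `+` B t0) < e / 2 by near: t; exact: cB.
rewrite (splitr e); apply: le_lt_trans (ltrD Ae Be); apply: mass_subU.
- by apply: measurableU; apply: measurableD.
- by apply: measurableU; apply: measurableD.
- by apply: measurableU; apply: measurableD; apply: measurableI.
- move=> x [[[At Bt]] n|[[At Bt]] n].
  + by have [A0|A0] := pselect (A t0 x); [right|left]; left; split => // B0; apply: n.
  + by have [A0|A0] := pselect (A t x); [right|left]; right; split => // B0; apply: n.
Unshelve. all: by end_near.
Qed.

Lemma mass_continuous_cvg (T : topologicalType) (A : T -> set X) (t0 : T) :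
  (forall t, measurable (A t)) -> mass_continuous_at A t0 ->
  mass (A t) @[t --> t0] --> mass (A t0).
Proof.
move=> mA cA; apply/cvgrPdist_lt => e e0; near=> t; rewrite distrC.
by apply: le_lt_trans (mass_dist (mA _) (mA _)) _; near: t; exact: cA.
Unshelve. all: by end_near.
Qed.

(** The sensitivity of [dot4 b x - u] to changes of its five coefficients; the summand 1 accounts
    for [u]. *)
Let norm1 (x : space4 R) : R := `|x.1.1.1| + `|x.1.1.2| + `|x.1.2| + `|x.2| + 1.

Let measurable_norm1 : measurable_fun [set: X] (norm1 : X -> measurableTypeR R).
Proof.
apply: measurable_funD; last exact: measurable_cst.
by do ! apply: measurable_funD; apply: measurableT_comp => //;
  rewrite /=; do ? [apply: measurableT_comp];
  by [exact: measurable_fst | exact: measurable_snd].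
Qed.

(** The points that may change sides when each coefficient changes by less than [k.+1%:R^-1]; for
    growing [k] these sets decrease to the hyperplane. *)
Let nbhd (b : space4 R) (u : R) (k : nat) : set X :=
  [set x | `|dot4 b x - u| <= k.+1%:R^-1 * norm1 x].

Let measurable_nbhd b u k : measurable (nbhd b u k).
Proof.
have mf : measurable_fun [set: X] (fun x => `|dot4 b x - u| <= k.+1%:R^-1 * norm1 x).
  apply: measurable_fun_ler.
    apply: measurableT_comp => //; apply: measurable_funB => //.
    exact: measurable_dot4.
  by apply: measurable_funM => //; exact: measurable_norm1.
rewrite -[X in measurable X]setTI.
by apply: (mf measurableT [set true]).
Qed.

Let norm1_gt0 x : 0 < norm1 x.
Proof. by rewrite /norm1 ltr_wpDl // !addr_ge0. Qed.

Let bigcap_nbhd b u : \bigcap_k (nbhd b u k) = hyperplane b u.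
Proof.
apply/seteqP; split => x /=; last first.
  by move=> xH k _; rewrite /nbhd /= xH subrr normr0 mulr_ge0 // ltW.
move=> h; apply/eqP; rewrite -subr_eq0 -normr_eq0 eq_le normr_ge0 andbT leNgt.
apply/negP => d0; have d1 : 0 < `|dot4 b x - u| / norm1 x by rewrite divr_gt0.
have [k _ hk] := near_infty_natSinv_lt (PosNum d1).
have := h k I; rewrite /nbhd /= leNgt => /negP; apply.
by rewrite -ltr_pdivlMr // hk //=.
Qed.

Let nbhd_small b u e : b != 0 \/ u != 0 -> 0 < e -> exists k, mass (nbhd b u k) < e.
Proof.
move=> bu e0.
have : mu (nbhd b u k) @[k --> \oo] --> mu (\bigcap_k nbhd b u k).
  apply: nonincreasing_cvg_mu => //.
  - by rewrite ltey_eq fin_num_measure.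
  - by rewrite bigcap_nbhd; exact: measurable_hyperplane.
  - move=> i j ij; apply/subsetPset => x /= h; apply: le_trans h _.
    rewrite ler_wpM2r ?(ltW (norm1_gt0 _)) // lef_pV2 ?posrE //.
    by rewrite ler_nat ltnS.
rewrite bigcap_nbhd massE; last exact: measurable_hyperplane.
rewrite mass_hyperplane // => /fine_cvg /cvgrPdist_lt /(_ _ e0) [k _ hk].
exists k; have := hk k (leqnn _); rewrite /= sub0r normrN.
by rewrite ger0_norm // mass_ge0.
Qed.

Lemma mass_continuous_halfspace (T : topologicalType) (b : T -> space4 R)
    (u : T -> R) (t0 : T) j :
  b t @[t --> t0] --> b t0 -> u t @[t --> t0] --> u t0 ->
  b t0 != 0 \/ u t0 != 0 -> mass_continuous_at (fun t => halfspace (b t) (u t) j) t0.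
Proof.
move=> cb cu bu e e0; have [k hk] := nbhd_small bu e0.
have k0 : 0 < (k.+1%:R^-1 : R) by rewrite invr_gt0.
near=> t.
apply: le_lt_trans hk; apply: le_mass => //.
  by apply: measurableU; apply: measurableD; exact: measurable_halfspace.
move=> x.
have hb : ball (b t0) (k.+1%:R^-1) (b t) by near: t; exact: cvg_ball.
have hu : `|u t0 - u t| < k.+1%:R^-1.
  by near: t; move/cvgrPdist_lt: cu; apply.
have [[[b1 b2] b3] b4] := hb.
have d : `|(dot4 (b t0) x - u t0) - (dot4 (b t) x - u t)| <= k.+1%:R^-1 * norm1 x.
  have -> : (dot4 (b t0) x - u t0) - (dot4 (b t) x - u t) =
    ((b t0).1.1.1 - (b t).1.1.1) * x.1.1.1 + ((b t0).1.1.2 - (b t).1.1.2) * x.1.1.2 +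
    ((b t0).1.2 - (b t).1.2) * x.1.2 + ((b t0).2 - (b t).2) * x.2 + - (u t0 - u t).
    by rewrite /dot4; ring.
  rewrite /norm1 !mulrDr mulr1.
  have le_mul (y w : R) : `|y| < k.+1%:R^-1 -> `|y * w| <= k.+1%:R^-1 * `|w|.
    by move=> yk; rewrite normrM ler_wpM2r // ltW.
  apply: (le_trans (ler_normD _ _)); apply: lerD; last by rewrite normrN ltW.
  do 3 (apply: (le_trans (ler_normD _ _)); apply: lerD; last exact: le_mul).
  exact: le_mul.
have dn := mulr_ge0 (ltW k0) (ltW (norm1_gt0 x)).
rewrite /nbhd /=; move: d; rewrite !ler_norml => /andP[d1 d2].
by case: j => -[] /= [] h1 /negP; rewrite -ltNge => h2; move: dn d1 d2 h1 h2;
  move: (_ * norm1 x) (dot4 (b t) x) (dot4 (b t0) x) (u t0) (u t) => D p q v w *;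
  apply/andP; split; lra.
Unshelve. all: by end_near.
Qed.

End MassDistribution.

(** * Slabs of equal mass *)

Section Slabs.
Context (R : realType) (mu : {finite_measure set (borel4 R) -> \bar R}).
Hypothesis hmu : mass_distribution mu.
Local Notation X := (borel4 R).
Local Notation mass := (mass mu).

Local Notation total := (mass [set: X]).

Let total_gt0 : 0 < total := mass_setT_gt0 hmu.

Lemma mass_halfspace_lt (a : space4 R) (s s' : R) : a != 0 -> s < s' ->
  mass (halfspace a s false) < mass (halfspace a s' false).
Proof.
move=> a0 ss'; have aa := dot4_self_gt0 a0.
pose U := [set x : space4 R | s < dot4 a x < s'].
have oU : open U.
  have c : continuous (dot4 a) by move=> x; apply: continuous_dot4; [exact: cvg_cst|exact: cvg_id].
  rewrite (_ : U = dot4 a @^-1` [set` `]s, s'[%R]).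
    by apply: open_comp => [x _|]; [exact: c | exact: interval_open].
  by apply/seteqP; split => x /=; rewrite in_itv.
have U0 : (0 < mu U)%E.
  apply: hmu.2 => //; exists (((s + s') / 2 / dot4 a a) *: a).
  by rewrite /U /= dot4Z divfK ?gt_eqF //; lra.
have hm j t := measurable_halfspace a t j.
have mD : measurable (halfspace a s' false `\` halfspace a s false : set X).
  exact: measurableD.
rewrite (mass_split mu (hm false s') (hm false s)).
rewrite (_ : _ `&` _ = halfspace a s false); last first.
  by apply/seteqP; split => x /= => [[]//|h]; split => //; apply: le_trans h _; exact: ltW.
rewrite ltrDl -lte_fin -massE //; apply: lt_le_trans U0 _.
apply: le_measure; rewrite ?inE //.
  rewrite (_ : U = ~` (halfspace a s false) `&` ~` (halfspace a s' true)).
    by apply: measurableI; apply: measurableC.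
  apply/seteqP; split => x /=; first by move=> /andP[? ?]; split; apply/negP; rewrite -ltNge.
  by move=> [/negP h1 /negP h2]; rewrite /U /= !ltNge h1.
move=> x /= /andP[x1 x2]; split; first exact: ltW.
by apply/negP; rewrite -ltNge.
Qed.

Lemma mass_halfspace_onto (a : space4 R) (r : R) : a != 0 -> 0 < r < total ->
  exists s, mass (halfspace a s false) = r.
Proof.
move=> a0 /andP[r0 r1].
have hm j t := measurable_halfspace a t j.
have cont : continuous (fun s => mass (halfspace a s false)).
  move=> s; apply: mass_continuous_cvg => //.
  apply: mass_continuous_halfspace => //; [exact: cvg_cst|by left].
have [N hN] : exists n : nat, mass (halfspace a (- n%:R) false) < r.
  have : mu (halfspace a (- k%:R) false) @[k --> \oo] -->
      mu (\bigcap_k halfspace a (- k%:R) false).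
    apply: nonincreasing_cvg_mu => //.
    - by rewrite ltey_eq fin_num_measure.
    - by apply: bigcap_measurable => //; exists 0%N.
    - move=> i j ij; apply/subsetPset => x /= h; apply: le_trans h _.
      by rewrite lerN2 ler_nat.
  rewrite (_ : \bigcap_k _ = set0); last first.
    apply/seteqP; split => // x /= h.
    have := archi_boundP (normr_ge0 (dot4 a x)); set k := Num.bound _ => hk.
    have := h k I; rewrite /halfspace /=; have := ler_norm (- dot4 a x); rewrite normrN; lra.
  rewrite measure0 => /fine_cvg /cvgrPdist_lt /(_ _ r0) [k _ hk].
  exists k; have := hk k (leqnn _); rewrite /= sub0r normrN.
  by rewrite ger0_norm // mass_ge0.
have [P hP] : exists n : nat, r < mass (halfspace a (n%:R) false).
  have : mu (halfspace a (k%:R) false) @[k --> \oo] -->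
      mu (\bigcup_k halfspace a (k%:R) false).
    apply: nondecreasing_cvg_mu => //.
    - by apply: bigcup_measurable.
    - move=> i j ij; apply/subsetPset => x /= h; apply: le_trans h _.
      by rewrite ler_nat.
  rewrite (_ : \bigcup_k _ = setT); last first.
    apply/seteqP; split => // x /= _.
    have := archi_boundP (normr_ge0 (dot4 a x)); set k := Num.bound _ => hk.
    exists k => //; rewrite /halfspace /=; have := ler_norm (dot4 a x); lra.
  have r10 : 0 < total - r by rewrite subr_gt0.
  rewrite (massE mu measurableT) => /fine_cvg /cvgrPdist_lt /(_ _ r10) [k _ hk].
  exists k; have := hk k (leqnn _); rewrite /= -/(mass _) -/(mass _) ltr_norml; lra.
have NP : - N%:R <= (P%:R : R).
  by apply: (@le_trans _ _ 0); rewrite ?oppr_le0 ler0n.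
have [||s _ hs] := @IVT R (fun s => mass (halfspace a s false)) _ _ r NP.
- exact: continuous_subspaceT.
- by rewrite ge_min le_max (ltW hN) (ltW hP) orbT.
- by exists s.
Qed.

(** The threshold is unique for [a != 0]; [xget] falls back on 0 where none exists, as for
    [a = 0]. *)
Definition third (a : space4 R) : R :=
  xget 0 [set s | mass (halfspace a s false) = total / 3].

Lemma mass_third a : a != 0 -> mass (halfspace a (third a) false) = total / 3.
Proof.
move=> a0; rewrite /third; case: xgetP => [s -> //|no].
have [|s hs] := @mass_halfspace_onto a (total / 3) a0; last by case: (no s).
by move: total_gt0 => ?; lra.
Qed.

(** Strict monotonicity puts the masses at [third (a t0) - e] and [third (a t0) + e] on either side
    of [total / 3]; this persists for nearby [t] and traps the new threshold. *)
Lemma continuous_third (T : topologicalType) (a : T -> space4 R) (t0 : T) :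
  a t @[t --> t0] --> a t0 -> a t0 != 0 -> third (a t) @[t --> t0] --> third (a t0).
Proof.
move=> ca a0; have hm b j t := @measurable_halfspace R b t j.
have cm s : mass (halfspace (a t) s false) @[t --> t0] --> mass (halfspace (a t0) s false).
  apply: mass_continuous_cvg => //.
  apply: mass_continuous_halfspace => //; [exact: cvg_cst|by left].
have ne : \forall t \near t0, a t != 0.
  have : \forall t \near t0, 0 < dot4 (a t) (a t0).
    apply: (cvgr_gt (dot4 (a t0) (a t0))); last exact: dot4_self_gt0.
    by apply: (@continuous_dot4 _ _ _ a (cst (a t0))) => //; exact: cvg_cst.
  by apply: filterS => t; apply: contraTneq => ->; rewrite dot40 ltxx.
have m0 := mass_third a0.
apply/cvgrPdist_le => e e0; near=> t.
have t_neq0 : a t != 0 by near: t.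
have mt := mass_third t_neq0.
have lo : mass (halfspace (a t) (third (a t0) - e) false) < total / 3.
  near: t; apply: (cvgr_lt _ (cm _)); rewrite -m0.
  by apply: mass_halfspace_lt => //; rewrite ltrBlDr ltrDl.
have up : total / 3 < mass (halfspace (a t) (third (a t0) + e) false).
  near: t; apply: (cvgr_gt _ (cm _)); rewrite -m0.
  by apply: mass_halfspace_lt => //; rewrite ltrDl.
rewrite ler_norml; apply/andP; split; rewrite leNgt; apply/negP => h.
- have : mass (halfspace (a t) (third (a t0) + e) false) <
         mass (halfspace (a t) (third (a t)) false).
    by apply: mass_halfspace_lt => //; lra.
  by rewrite mt; lra.
- have : mass (halfspace (a t) (third (a t)) false) <
         mass (halfspace (a t) (third (a t0) - e) false).
    by apply: mass_halfspace_lt => //; lra.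
  by rewrite mt; lra.
Unshelve. all: by end_near.
Qed.

(* The second threshold is the first one for the opposite normal, so that
   a |-> - a exchanges the outer slabs. *)
Definition slab3 (a : space4 R) : 'I_3 -> set X := slab a (third a) (- third (- a)).

Lemma slabE (a : space4 R) s t (i : 'I_3) : slab a s t i =
  if val i == 0%N then halfspace a s false else if val i == 1%N then
    halfspace a s true `&` halfspace a t false else halfspace a t true.
Proof.
case: i => [[|[|[|i]]] hi] //; apply/seteqP; split => x //=.
  by rewrite /slab /= => /andP.
by rewrite /slab /= => -[? ?]; apply/andP.
Qed.

Lemma measurable_slab (a : space4 R) s t i : measurable (slab a s t i : set X).
Proof.
rewrite slabE; do ? case: ifP => _; try exact: measurable_halfspace.
by apply: measurableI; exact: measurable_halfspace.
Qed.

Lemma slab3N a i : slab3 (- a) i = slab3 a (rev_ord i).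
Proof.
rewrite /slab3 !slabE opprK.
have e (u : R) j : halfspace (- a) u j = halfspace a (- u) (~~ j).
  by rewrite -halfspaceN opprK.
by rewrite !e opprK; case: i => [[|[|[|i]]] hi] //=; rewrite setIC.
Qed.

(** Otherwise the two outer slabs would cover the space with only two thirds of its mass. *)
Lemma third_lt a : a != 0 -> third a < - third (- a).
Proof.
move=> a0; rewrite ltNge; apply/negP => h.
have Na0 : - a != 0 by rewrite oppr_eq0.
have hm b j t := @measurable_halfspace R b t j.
have := mass_third a0; have := mass_third Na0.
have : total <= mass (halfspace a (third a) false) + mass (halfspace (- a) (third (- a)) false).
  apply: mass_subU => // x _.
  rewrite -[third (- a)]opprK halfspaceN /=.
  by have [?|?] := leP (dot4 a x) (third a); [left|right]; rewrite /halfspace //=; lra.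
by move: total_gt0; lra.
Qed.

Lemma mass_slab3 a i : a != 0 -> mass (slab3 a i) = total / 3.
Proof.
move=> a0; have Na0 : - a != 0 by rewrite oppr_eq0.
have hm b j t := @measurable_halfspace R b t j.
have e0 : mass (slab3 a ord0) = total / 3 by rewrite /slab3 slabE mass_third.
have e2 : mass (slab3 a ord_max) = total / 3.
  by rewrite -[a]opprK slab3N /slab3 slabE /= mass_third // opprK.
case: i => [[|[|[|i]]] hi].
- by rewrite (_ : Ordinal hi = ord0) // ; apply: val_inj.
(* The middle slab gets the remaining third, since the slabs overlap only in null hyperplanes. *)
- have tl := third_lt a0.
  rewrite /slab3 slabE /=; move: e0 e2; rewrite /slab3 !slabE /=.
  set s := third a; set t := - third (- a) => e0 e2.
  have h1 := mass_split mu (measurableT : measurable (setT : set X)) (hm a false s).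
  have h2 := mass_split mu (hm a true s) (hm a false t).
  have n1 := mass_hyperplane hmu (or_introl a0 : a != 0 \/ s != 0).
  have n2 := mass_hyperplane hmu (or_introl a0 : a != 0 \/ t != 0).
  have mh u := @measurable_hyperplane R a u.
  have l1 : mass (halfspace a s true) <= mass (setT `\` halfspace a s false) + mass (hyperplane a s).
    apply: mass_subU => //; first exact: measurableD.
    move=> x /= sx; have [|h] := eqVneq (dot4 a x) s; [by right|left; split => // h'].
    by move: h; rewrite eq_le h' sx.
  have l1' : mass (setT `\` halfspace a s false) <= mass (halfspace a s true).
    apply: le_mass => //; first exact: measurableD.
    by move=> x /= [_ /negP]; rewrite -ltNge => /ltW.
  have l2 : mass (halfspace a t true) <=
      mass (halfspace a s true `\` halfspace a t false) + mass (hyperplane a t).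
    apply: mass_subU => //; first exact: measurableD.
    move=> x /= sx; have [|h] := eqVneq (dot4 a x) t; [by right|left; split].
      by apply: le_trans sx; exact: ltW.
    by move=> h'; move: h; rewrite eq_le h' sx.
  have l2' : mass (halfspace a s true `\` halfspace a t false) <= mass (halfspace a t true).
    apply: le_mass => //; first exact: measurableD.
    by move=> x /= [_ /negP]; rewrite -ltNge => /ltW.
  by move: h1; rewrite setTI; lra.
- by rewrite (_ : Ordinal hi = ord_max) //; apply: val_inj.
- by [].
Qed.

Lemma mass_continuous_slab3 (T : topologicalType) (a : T -> space4 R) (t0 : T) i :
  a t @[t --> t0] --> a t0 -> a t0 != 0 ->
  mass_continuous_at mu (fun t => slab3 (a t) i) t0.
Proof.
move=> ca a0; rewrite /slab3.
have Na0 : - a t0 != 0 by rewrite oppr_eq0.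
have c1 := continuous_third ca a0.
have c2 : - third (- a t) @[t --> t0] --> - third (- a t0).
  by apply: cvgN; apply: continuous_third => //; exact: cvgN.
have hm b j t := @measurable_halfspace R b t j.
under [X in mass_continuous_at _ X]eq_fun do rewrite slabE.
do 2 ?[case: ifP => _]; try by apply: mass_continuous_halfspace => //; left.
by apply: mass_continuousI => //; apply: mass_continuous_halfspace => //; left.
Qed.

End Slabs.

(** * Parallel hyperplanes *)

Section Parallel.
Context (R : realType).

(** Translation by a vector orthogonal to [a] preserves the first hyperplane, hence also the second;
    so [dot4 b] vanishes on the kernel of [dot4 a]. *)
Lemma parallel_dot4 (a b : space4 R) (s u : R) : a != 0 -> b != 0 ->
  parallel (hyperplane a s) (hyperplane b u) ->
  exists2 l, l != 0 & forall x, dot4 b x = l * dot4 a x.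
Proof.
move=> a0 b0 [v Kv]; have aa := dot4_self_gt0 a0; have bb := dot4_self_gt0 b0.
have H x : dot4 a x = s -> dot4 b (x + v) = u.
  move=> ax; have : (hyperplane b u) (x + v) by rewrite Kv; exists x.
  by [].
have [x0 hx0] : exists x0, dot4 a x0 = s.
  by exists ((s / dot4 a a) *: a); rewrite dot4Z divfK // gt_eqF.
have E x : dot4 b x = dot4 b a / dot4 a a * dot4 a x.
  pose k := dot4 a x / dot4 a a.
  have : dot4 b (x0 + (x + (- k) *: a) + v) = u.
    by apply: H; rewrite !dot4D !dot4Z hx0 mulNr divfK ?gt_eqF // subrr addr0.
  have := H _ hx0; rewrite !dot4D dot4Z => h1 h2.
  have -> : dot4 b x = k * dot4 b a by lra.
  by rewrite /k; ring.
exists (dot4 b a / dot4 a a) => //.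
by apply: contraTneq bb => l0; rewrite E l0 mul0r ltxx.
Qed.

Lemma halfspaceZ (a b : space4 R) (u l : R) : l != 0 ->
  (forall x, dot4 b x = l * dot4 a x) ->
  exists w, forall j, halfspace b u j = halfspace a w (if 0 < l then j else ~~ j).
Proof.
move=> l0 E; exists (u / l) => j.
case: ltP => hl.
  by case: j; apply/seteqP; split => x /=; rewrite E [l * _]mulrC ?ler_pdivrMr ?ler_pdivlMr //.
have {}hl : l < 0 by rewrite lt_neqAle l0.
by case: j; apply/seteqP; split => x /=; rewrite E [l * _]mulrC ?ler_ndivrMr ?ler_ndivlMr //.
Qed.

End Parallel.

(** * The nine test functions *)

(** Block 0 holds the two coordinates of the second hyperplane, block 1 the four of the first, block
    2 the three of the slab normal. *)
Definition block_of (d : 'I_9) : 'I_3 :=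
  if (d < 2)%N then @Ordinal 3 0 isT else if (d < 6)%N then @Ordinal 3 1 isT
  else @Ordinal 3 2 isT.

(* The i-th test function is odd in the second hyperplane when [odd_c i], in the
   first when [odd_b i], and in the common normal of the slabs when [odd_a i]. *)
Definition odd_c (i : 'I_9) := val i \in [:: 0; 1; 4; 5; 7; 8]%N.
Definition odd_b (i : 'I_9) := val i \in [:: 2; 3; 4; 5; 6; 8]%N.
Definition odd_a (i : 'I_9) := (5 < i)%N.
(** Tests 0, 2, 4 are the conditions on c, b and bc in the middle slab; 1, 3, 5 are the same for the
    sum of the outer slabs, and 7, 6, 8 for their difference. *)
Definition middle (i : 'I_9) := val i \in [:: 0; 2; 4]%N.

Definition parity (i : 'I_9) : pred 'I_3 := fun B =>
  if val B == 0%N then odd_c i else if val B == 1%N then odd_b i else odd_a i.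

Lemma parity_diag i : parity i (block_of i).
Proof. by case: i => [[|[|[|[|[|[|[|[|[|i]]]]]]]]] hi]. Qed.

(* Reading the product of the characters from left to right, the monomial
   c^2 b^4 a^3 is obtained in exactly one way. *)
Lemma parity_min (i d : 'I_9) : (i <= d)%N ->
  (forall d' : 'I_9, (i <= d')%N -> block_of d' = block_of d -> (d <= d')%N) ->
  parity i (block_of d) -> d = i.
Proof.
move=> le_id hmin par; apply: ord_inj; apply/eqP; rewrite eqn_leq le_id andbT.
rewrite leqNgt; apply/negP => lt_id.
have lt_d : (d.-1 < 9)%N by have := ltn_ord d; lia.
(* Tests 0 and 1 are even in block 1 and tests 0 to 5 in block 2, so [d] does not open its block and
   [d.-1] lies in it. *)
have : (d <= Ordinal lt_d)%N by apply: hmin => /=; [lia|]; apply: val_inj;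
  move: par lt_id lt_d {le_id};
  case: i => [[|[|[|[|[|[|[|[|[|i]]]]]]]]] hi];
  case: d => [[|[|[|[|[|[|[|[|[|d]]]]]]]]] hd].
by move=> /=; lia.
Qed.

(** * The test functions of a mass distribution *)

Section Equipartition.
Context (R : realType) (mu : {finite_measure set (borel4 R) -> \bar R}).
Hypothesis hmu : mass_distribution mu.
Local Notation X := (borel4 R).
Local Notation mass := (mass mu).

Implicit Type x : 'rV[R]_9.

Let co x (k : nat) : R := x 0 (inord k).
(* [a], [(b, u)] and [(c, v)] never vanish, and they are odd on the boundary of
   their cubes because their last components vanish there. *)
Let bump x k : R := 1 - co x k ^+ 2.

Let a x : space4 R :=
  (co x 6, co x 7, co x 8, bump x 6 * bump x 7 * bump x 8).
Let b x : space4 R := (co x 2, co x 3, co x 4, co x 5).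
Let u x : R := bump x 2 * bump x 3 * bump x 4 * bump x 5.
(** With two components of the normal fixed at 0, the second hyperplane takes two parameters, for
    nine in all. *)
Let c x : space4 R := (co x 0, co x 1, 0, 0).
Let v x : R := bump x 0 * bump x 1.

Let co_neg B x k : (k < 9)%N ->
  co (neg_row block_of B x) k = if block_of (inord k) == B then - co x k else co x k.
Proof. by move=> k9; rewrite /co mxE. Qed.

Let block_inord k : (k < 9)%N ->
  val (block_of (inord k)) = if (k < 2)%N then 0%N else if (k < 6)%N then 1%N else 2%N.
Proof. by move=> k9; rewrite /block_of inordK //; do ! case: ifP. Qed.

Let co_negE (B : 'I_3) x k : (k < 9)%N -> co (neg_row block_of B x) k =
  if (if (k < 2)%N then 0%N else if (k < 6)%N then 1%N else 2%N) == B :> nat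
  then - co x k else co x k.
Proof. by move=> k9; rewrite co_neg // -(inj_eq val_inj) block_inord. Qed.

Let bump_neg (B : 'I_3) x k : (k < 9)%N -> bump (neg_row block_of B x) k = bump x k.
Proof. by move=> k9; rewrite /bump co_negE //; case: ifP; rewrite ?sqrrN. Qed.

Let bump_bd x k : `|x 0 (inord k)| = 1 -> bump x k = 0.
Proof. by move=> h; rewrite /bump /co -real_normK ?num_real // h expr1n subrr. Qed.

Let bump1 x k : co x k = 0 -> bump x k = 1.
Proof. by move=> h; rewrite /bump h expr0n subr0. Qed.

Let a_neq0 x : a x != 0.
Proof.
apply/eqP => -[h6 h7 h8]; rewrite !bump1 // !mulr1 => /eqP.
by rewrite oner_eq0.
Qed.

Let bu_neq0 x : b x != 0 \/ u x != 0.
Proof.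
have [[h2 h3 h4 h5]|] := eqVneq (b x) 0; last by left.
by right; rewrite /u !bump1 // !mulr1 oner_eq0.
Qed.

Let cv_neq0 x : c x != 0 \/ v x != 0.
Proof.
have [[h0 h1]|] := eqVneq (c x) 0; last by left.
by right; rewrite /v !bump1 // !mulr1 oner_eq0.
Qed.

Let S i x := slab3 mu (a x) i.
Let HB j x := halfspace (b x) (u x) j.
Let HC j x := halfspace (c x) (v x) j.

Let on_bd (B : 'I_3) x := exists2 d, block_of d = B & `|x 0 d| = 1.

Let bd_prod (B : 'I_3) x : on_bd B x ->
  [/\ val B == 2%N -> bump x 6 * bump x 7 * bump x 8 = 0,
      val B == 1%N -> u x = 0 & val B == 0%N -> v x = 0].
Proof.
move=> [d <- xd]; have : bump x (val d) = 0 by apply: bump_bd; rewrite inord_val.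
rewrite /u /v; case: d {xd} => [[|[|[|[|[|[|[|[|[|d]]]]]]]]] hd] //= h;
  by split=> e; first [by [] | by rewrite h ?mulr0 ?mul0r].
Qed.

Let S_neg (B : 'I_3) i x : on_bd B x ->
  S i (neg_row block_of B x) = S (if val B == 2%N then rev_ord i else i) x.
Proof.
move=> /bd_prod[h _ _]; rewrite /S.
have -> : a (neg_row block_of B x) = if val B == 2%N then - a x else a x.
  rewrite /a !co_negE // !bump_neg //= eq_sym; case: ifP => // B2.
  by rewrite h // -[in LHS]oppr0.
by case: ifP => // _; rewrite slab3N.
Qed.

Let HB_neg (B : 'I_3) j x : on_bd B x ->
  HB j (neg_row block_of B x) = HB (if val B == 1%N then ~~ j else j) x.
Proof.
move=> /bd_prod[_ h _]; rewrite /HB.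
have -> : b (neg_row block_of B x) = if val B == 1%N then - b x else b x.
  by rewrite /b !co_negE //= eq_sym; case: ifP.
have -> : u (neg_row block_of B x) = if val B == 1%N then - u x else u x.
  have -> : u (neg_row block_of B x) = u x by rewrite /u !bump_neg.
  by case: ifP => // /h ->; rewrite oppr0.
by case: ifP => // _; rewrite halfspaceN.
Qed.

Let HC_neg (B : 'I_3) j x : on_bd B x ->
  HC j (neg_row block_of B x) = HC (if val B == 0%N then ~~ j else j) x.
Proof.
move=> /bd_prod[_ _ h]; rewrite /HC.
have -> : c (neg_row block_of B x) = if val B == 0%N then - c x else c x.
  rewrite /c !co_negE //= eq_sym; case: ifP => // _.
  by congr (_, _, _, _); rewrite -[LHS]oppr0.
have -> : v (neg_row block_of B x) = if val B == 0%N then - v x else v x.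
  have -> : v (neg_row block_of B x) = v x by rewrite /v !bump_neg.
  by case: ifP => // /h ->; rewrite oppr0.
by case: ifP => // _; rewrite halfspaceN.
Qed.

Let q i j k x := mass (S i x `&` HB j x `&` HC k x).

(** The integral over slab [i] of the product of the sign functions selected by [odB] and [odC]. *)
Let g (odB odC : bool) i x : R :=
  q i true true x + (-1) ^+ odC * q i true false x +
  (-1) ^+ odB * q i false true x + (-1) ^+ odB * (-1) ^+ odC * q i false false x.

Let f (n : 'I_9) x : R :=
  if middle n then g (odd_b n) (odd_c n) (@Ordinal 3 1 isT) x
  else g (odd_b n) (odd_c n) ord0 x + (-1) ^+ odd_a n * g (odd_b n) (odd_c n) ord_max x.

Let q_neg (B : 'I_3) i j k x : on_bd B x -> q i j k (neg_row block_of B x) =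
  q (if val B == 2%N then rev_ord i else i) (if val B == 1%N then ~~ j else j)
    (if val B == 0%N then ~~ k else k) x.
Proof. by move=> h; rewrite /q S_neg // HB_neg // HC_neg. Qed.

Let f_neg n (B : 'I_3) x : on_bd B x ->
  f n (neg_row block_of B x) = (-1) ^+ parity n B * f n x.
Proof.
move=> h; rewrite /f /g !q_neg // /parity; case: B h => [[|[|[|B]]] hB] //= _.
- by case: (odd_b n); case: (odd_c n); case: (odd_a n); case: ifP => _;
    rewrite ?expr0 ?expr1; ring.
- by case: (odd_b n); case: (odd_c n); case: (odd_a n); case: ifP => _;
    rewrite ?expr0 ?expr1; ring.
have -> : rev_ord (@Ordinal 3 1 isT) = Ordinal (isT : 1 < 3)%N by exact: val_inj.
have -> : rev_ord (@ord0 2) = ord_max by exact: val_inj.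
have -> : rev_ord (@ord_max 2) = ord0 by exact: val_inj.
(* Reversal fixes the middle slab, so tests there must be even in the slab normal. *)
have : odd_a n -> ~~ middle n.
  by case: n => [[|[|[|[|[|[|[|[|[|n]]]]]]]]] hn].
case: (odd_a n) => [/(_ isT) /negbTE ->|_].
  by case: (odd_b n); case: (odd_c n); rewrite ?expr0 ?expr1; ring.
by case: ifP => _; case: (odd_b n); case: (odd_c n); rewrite ?expr0 ?expr1; ring.
Qed.

Let co_cont k x : co y k @[y --> x] --> co x k.
Proof. exact: coord_continuous. Qed.

Let cst_cont (r : R) x : (fun=> r) y @[y --> x] --> r.
Proof. exact: (@cvg_cst _ r _ (nbhs x) (nbhs_filter x)). Qed.

Let bump_cont k x : bump y k @[y --> x] --> bump x k.
Proof.
have h := @co_cont k x; exact: cvgB (@cst_cont 1 x) (cvgM h h).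
Qed.

Let quad_cont (f1 f2 f3 f4 : 'rV[R]_9 -> R) x :
  f1 y @[y --> x] --> f1 x -> f2 y @[y --> x] --> f2 x ->
  f3 y @[y --> x] --> f3 x -> f4 y @[y --> x] --> f4 x ->
  ((f1 y, f2 y, f3 y, f4 y) : space4 R) @[y --> x] --> ((f1 x, f2 x, f3 x, f4 x) : space4 R).
Proof.
move=> c1 c2 c3 c4.
exact: cvg_pair (cvg_pair (cvg_pair c1 c2) c3) c4.
Qed.

Let q_cont i j k x : q i j k y @[y --> x] --> q i j k x.
Proof.
have B n := @bump_cont n x.
have ca : a y @[y --> x] --> a x.
  apply: quad_cont; do ? exact: co_cont.
  exact: cvgM (cvgM (B 6) (B 7)) (B 8).
have cb : b y @[y --> x] --> b x by apply: quad_cont; exact: co_cont.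
have cc : c y @[y --> x] --> c x.
  have z := @cst_cont 0 x.
  exact: (quad_cont (@co_cont 0 x) (@co_cont 1 x) z z).
have cu : u y @[y --> x] --> u x.
  exact: cvgM (cvgM (cvgM (B 2) (B 3)) (B 4)) (B 5).
have cv : v y @[y --> x] --> v x by exact: cvgM (B 0) (B 1).
have mS y : measurable (S i y : set X) by exact: measurable_slab.
have mB y : measurable (HB j y : set X) by exact: measurable_halfspace.
have mC y : measurable (HC k y : set X) by exact: measurable_halfspace.
apply: mass_continuous_cvg; first by move=> y; do ? apply: measurableI.
apply: mass_continuousI => //; last exact: mass_continuous_halfspace.
  by move=> y; apply: measurableI.
apply: mass_continuousI => //; last exact: mass_continuous_halfspace.
exact: mass_continuous_slab3.
Qed.

Let g_cont s t i x : g s t i y @[y --> x] --> g s t i x.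
Proof.
have Q j k := @q_cont i j k x; have C r := @cst_cont r x.
exact: cvgD (cvgD (cvgD (Q true true) (cvgM (C _) (Q true false)))
  (cvgM (C _) (Q false true))) (cvgM (C _) (Q false false)).
Qed.

Let f_cont n : continuous (f n).
Proof.
move=> x; rewrite /f; case: (middle n); first exact: g_cont.
have G i := @g_cont (odd_b n) (odd_c n) i x.
exact: cvgD (G ord0) (cvgM (@cst_cont ((-1) ^+ odd_a n) x) (G ord_max)).
Qed.

Let mass_halves (A : set X) (w : space4 R) (r : R) :
  measurable A -> w != 0 \/ r != 0 ->
  mass A = mass (A `&` halfspace w r true) + mass (A `&` halfspace w r false).
Proof.
move=> mA wr; have hm j := measurable_halfspace w r j.
have mH := measurable_hyperplane w r.
rewrite (mass_split mu mA (hm true)); congr (_ + _).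
have l1 : mass (A `\` halfspace w r true) <= mass (A `&` halfspace w r false).
  apply: le_mass; [exact: measurableD|exact: measurableI|].
  by move=> x [Ax /negP]; rewrite -ltNge => /ltW ?.
have l2 : mass (A `&` halfspace w r false) <=
    mass (A `\` halfspace w r true) + mass (hyperplane w r).
  apply: mass_subU => //; [exact: measurableD|exact: measurableI|].
  move=> x [Ax /= h]; have [|ne] := eqVneq (dot4 w x) r; [by right|left; split => //].
  by move=> /= h'; move: ne; rewrite eq_le h h'.
by move: l2; rewrite mass_hyperplane // addr0 => l2; apply/le_anti; rewrite l1.
Qed.

Local Notation total := (mass [set: X]).

Let q_sum i x :
  q i true true x + q i true false x + q i false true x + q i false false x = total / 3.
Proof.
rewrite -(mass_slab3 hmu i (a_neq0 x)).
have mS : measurable (S i x : set X) by exact: measurable_slab.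
have mB j : measurable (HB j x : set X) by exact: measurable_halfspace.
rewrite -/(S i x) (mass_halves mS (bu_neq0 x)) -/(HB true x) -/(HB false x).
rewrite (mass_halves (measurableI _ _ mS (mB true)) (cv_neq0 x)).
by rewrite (mass_halves (measurableI _ _ mS (mB false)) (cv_neq0 x)) !addrA.
Qed.

Let equal_boxes : exists x, forall i j k, q i j k x = total / 12.
Proof.
have [x fx] := cube_common_zero parity_diag parity_min f_cont
  (fun n B x _ h => f_neg n h).
exists x => i j k.
(* For an outer slab, the vanishing sum and difference are combined. *)
have [g1 [g2 g3]] : g true false i x = 0 /\ g false true i x = 0 /\ g true true i x = 0.
  have F (m : nat) (hm : (m < 9)%N) := fx (Ordinal hm).
  have := F 0%N isT; have := F 1%N isT; have := F 2%N isT; have := F 3%N isT.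
  have := F 4%N isT; have := F 5%N isT; have := F 6%N isT; have := F 7%N isT.
  have := F 8%N isT; rewrite /f /middle /odd_a /odd_b /odd_c /= ?expr0 ?expr1.
  have : [\/ i = ord0, i = @Ordinal 3 1 isT | i = ord_max].
    by case: i => [[|[|[|i]]] hi] //; [apply: Or31|apply: Or32|apply: Or33]; apply: val_inj.
  by case=> ->; move=> *; do ! split; lra.
(* The three vanishing integrals and the mass of the slab form an invertible linear system for its
   four boxes. *)
have := q_sum i x; move: g1 g2 g3; rewrite /g expr0 expr1.
by case: j; case: k => *; lra.
Qed.

Lemma exists_equal_boxes : exists (a b c : space4 R) (u v : R),
  [/\ a != 0, b != 0 \/ u != 0, c != 0 \/ v != 0 &
    forall i j k, mass (slab3 mu a i `&` halfspace b u j `&` halfspace c v k) =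
      total / 12].
Proof.
have [x qx] := equal_boxes.
exists (a x), (b x), (c x), (u x), (v x); split => //.
Qed.

End Equipartition.

(** * Nondegeneracy of the four hyperplanes *)

Theorem claim2 (R : realType)
    (mu : {finite_measure set (borel4 R) -> \bar R})
    (hmu : mass_distribution mu) :
  exists (a b c : space4 R) (s t u v : R),
    [/\ a != 0, b != 0 & c != 0] /\
    s < t /\
    [/\ ~ parallel (hyperplane a s) (hyperplane b u),
        ~ parallel (hyperplane a s) (hyperplane c v) &
        ~ parallel (hyperplane b u) (hyperplane c v)] /\
    forall (i : 'I_3) (j k : bool),
      mu (slab a s t i `&` halfspace b u j `&` halfspace c v k) =
      ((12%:R^-1)%:E * mu [set: borel4 R])%E.
Proof.
have [a [b [c [u [v [a0 bu cv boxE]]]]]] := exists_equal_boxes hmu.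
pose S i := slab3 mu a i; pose HB := halfspace b u; pose HC := halfspace c v.
have q0 i j k : 0 < mass mu (S i `&` HB j `&` HC k).
  by rewrite boxE divr_gt0 // mass_setT_gt0.
have mS i : measurable (S i : set (borel4 R)) by exact: measurable_slab.
have mB j : measurable (HB j : set (borel4 R)) by exact: measurable_halfspace.
have mC j : measurable (HC j : set (borel4 R)) by exact: measurable_halfspace.
have mq i j k : measurable (S i `&` HB j `&` HC k).
  by do ! apply: measurableI.
have nonempty i j k : exists y, [/\ S i y, HB j y & HC k y].
  have [[y [[? ?] ?]]|] := pselect ((S i `&` HB j `&` HC k) !=set0); first by exists y.
  move=> /set0P/negP; rewrite negbK => /eqP e.
  by have := q0 i j k; rewrite e /mass measure0 ltxx.
(* With zero normal and nonzero offset one of the two half-spaces would be empty, although it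
   contains a box of positive mass. *)
have b0 : b != 0.
  apply/eqP => e; have := nonempty ord0 true true; have := nonempty ord0 false true.
  case=> y [_ + _] [z [_ + _]]; rewrite /HB /halfspace /= e !dot40 => h1 h2.
  by case: bu; rewrite ?e ?eqxx // eq_le h1 h2.
have c0 : c != 0.
  apply/eqP => e; have := nonempty ord0 true true; have := nonempty ord0 true false.
  case=> y [_ _ +] [z [_ _ +]]; rewrite /HC /halfspace /= e !dot40 => h1 h2.
  by case: cv; rewrite ?e ?eqxx // eq_le h1 h2.
have st := third_lt hmu a0.
(* A hyperplane parallel to the slabs cannot meet both outer slabs. *)
have outer (w : space4 R) r : w != 0 ->
    (forall i j, exists2 y, S i y & halfspace w r j y) ->
    ~ parallel (hyperplane a (third mu a)) (hyperplane w r).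
  move=> w0 hw par; have [l l0 E] := parallel_dot4 a0 w0 par.
  have [r' hr] := halfspaceZ r l0 E.
  have h i j : exists2 y, S i y & halfspace a r' j y.
    have [y Sy hy] := hw i (if 0 < l then j else ~~ j); exists y => //.
    by move: hy; rewrite hr; case: (0 < l); rewrite ?negbK.
  have [y ya yh] := h ord0 true; have [z za zh] := h ord_max false.
  move: ya yh za zh; rewrite /S /slab3 /slab /halfspace /= => *; lra.
exists a, b, c, (third mu a), (- third mu (- a)), u, v.
split; first by [].
split; first by [].
split; last first.
  move=> i j k; rewrite [LHS](massE mu (mq i j k)) (massE mu measurableT) -EFinM.
  by rewrite boxE mulrC.
split.
- apply: outer => // i j; have [y [? ? ?]] := nonempty i j true; by exists y.
- apply: outer => // i j; have [y [? ? ?]] := nonempty i true j; by exists y.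
(* If b and c were parallel, one of the four quadrants would be null. *)
move=> par; have [l l0 E] := parallel_dot4 b0 c0 par.
have [r hr] := halfspaceZ v l0 E.
have key j j' : ~ HB j `&` halfspace b r j' `<=` hyperplane b u.
  move=> sub; have := q0 ord0 j (if 0 < l then j' else ~~ j').
  have hC y : HC (if 0 < l then j' else ~~ j') y -> halfspace b r j' y.
    by rewrite /HC hr; case: (0 < l); rewrite ?negbK.
  rewrite ltNge => /negP; apply.
  rewrite -[leRHS](mass_hyperplane hmu (or_introl b0 : b != 0 \/ u != 0)).
  apply: le_mass => //; first exact: measurable_hyperplane.
  by move=> y [[_ h1] h2]; apply: sub; split => //; exact: hC.
(* Depending on the order of the two levels, one pair of opposite half-spaces meets at most in the
   hyperplane of [b]. *)
have [ru|ur] := leP r u.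
  apply: (key true false) => y; rewrite /HB /halfspace /hyperplane /= => -[h1 h2].
  by apply: le_anti; rewrite h1 (le_trans h2 ru).
apply: (key false true) => y; rewrite /HB /halfspace /hyperplane /= => -[h1 h2].
by have := lt_le_trans ur (le_trans h2 h1); rewrite ltxx.
Qed.
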